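(* Let $\Omega\subset\mathbb{C}^n$ be a hyperbolic domain, let $\lambda\ge 1$, and assume that $\Omega$ is hyperbolic at $p\in\partial\Omega$. Then the following are equivalent: (1) $p$ is a $\lambda$-visible point for $\Omega$. (2) There exists a bounded neighbourhood $U$ of $p$ such that $p$ is a $\lambda$-visible point for $\Omega\cap U$. (3) For any bounded neighbourhood $U$ of $p$, $p$ is a $\lambda$-visible point for $\Omega\cap U$.
   Context: Neighbourhoods are open subsets of $\mathbb{C}^n$; $A\subset\subset B$ means that the closure of $A$ is compact and contained in $B$. $\Delta\subset\mathbb{C}$ is the open unit disc. For a domain $\Omega\subset\mathbb{C}^n$, $z,w\in\Omega$, $v\in\mathbb{C}^n$: $\tilde l_\Omega(z,w)=\inf\{|\alpha|:\exists\,\varphi:\Delta\to\Omega \text{ holomorphic},\ \varphi(0)=z,\ \varphi(\alpha)=w\}$; the Lempert function is $l_\Omega(z,w)=\tanh^{-1}\tilde l_\Omega(z,w)$; the Kobayashi pseudodistance $k_\Omega$ is the largest pseudodistance on $\Omega$ not exceeding $l_\Omega$; the Kobayashi-Royden pseudometric is $\kappa_\Omega(z;v)=\inf\{|\alpha|:\exists\,\varphi:\Delta\to\Omega \text{ holomorphic},\ \varphi(0)=z,\ \alpha\varphi'(0)=v\}$. For an absolutely continuous curve $\gamma:I\to\Omega$ ($I$ a compact interval), its Kobayashi-Royden length is $l^\kappa_\Omega(\gamma)=\int_I\kappa_\Omega(\gamma(t);\gamma'(t))\,dt$. For an open set such as $\Omega\cap U$ that may be disconnected, these objects are computed in the relevant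 connected component. $\Omega$ is hyperbolic if $k_\Omega$ is a distance. For $p\in\partial\Omega$, $\Omega$ is said to be hyperbolic at $p$ if either $\Omega$ is bounded, or $\Omega$ is unbounded and $\liminf_{z\to p,\,w\to\infty} l_\Omega(z,w)>0$ (with $z,w\in\Omega$). For $\lambda\ge1$, $\epsilon\ge0$, an absolutely continuous curve $\gamma:I\to\Omega$ is a $(\lambda,\epsilon)$-geodesic for $\Omega$ if $l^\kappa_\Omega(\gamma|_{[t_1,t_2]})\le\lambda k_\Omega(\gamma(t_1),\gamma(t_2))+\epsilon$ for all $t_1\le t_2$ in $I$. A point $p\in\partial\Omega$ is a $(\lambda,\epsilon)$-visible point for $\Omega$ if for any bounded neighbourhood $U$ of $p$ there exist a neighbourhood $V\subset\subset U$ of $p$ and a compact set $K_{\lambda,\epsilon}\subset\Omega$ such that every $(\lambda,\epsilon)$-geodesic $\gamma:I\to\Omega$ for $\Omega$ joining a point of $\Omega\cap V$ to a point of $\Omega\setminus U$ satisfies $\gamma(I)\cap K_{\lambda,\epsilon}\ne\emptyset$. It is a $\lambda$-visible point for $\Omega$ if it is $(\lambda,\epsilon)$-visible for $\Omega$ for all $\epsilon\ge0$. The same definitions are used with $\Omega$ replaced by the open set $\Omega\cap U$. *)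

(* Defs.v *)
From HB Require Import structures.
From mathcomp Require Import all_boot all_order all_algebra.
From mathcomp Require Import all_classical all_reals all_analysis.
From mathcomp Require Import complex.

Set Implicit Arguments.
Unset Strict Implicit.
Unset Printing Implicit Defensive.

Import Order.TTheory GRing.Theory Num.Theory.
Import numFieldNormedType.Exports.

Local Open Scope classical_set_scope.
Local Open Scope ring_scope.

(* MathComp-Analysis attaches the topology and the norm to an object of type
   numFieldType, so they are found on [Cx R] but not on [R[i]] itself.  The
   norms on [Cx R] and ['rV[Cx R]_n] take their values in [Cx R]; the latter is
   the sup norm of the coordinates, equivalent to the Euclidean one. *)
Definition Cx (R : realType) : numFieldType := R[i]%C.

Definition modulus (R : realType) (a : Cx R) : R := complex.Re `|a|.

Definition boundary (T : topologicalType) (A : set T) : set T :=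
  closure A `\` A°.

Definition neighbourhood (T : topologicalType) (p : T) (U : set T) : Prop :=
  open U /\ U p.

Definition relatively_compact_in (T : topologicalType) (A B : set T) : Prop :=
  compact (closure A) /\ closure A `<=` B.

Definition domain (T : topologicalType) (Omega : set T) : Prop :=
  [/\ open Omega, connected Omega & Omega !=set0].

Definition unit_disc (R : realType) : set (Cx R) := [set z | `|z| < 1].

(* Only the restriction of [phi] to the disc matters; [derivable] is complex
   differentiability, since the scalar field is [Cx R]. *)
Definition holomorphic_disc (R : realType) (n : nat)
    (Omega : set 'rV[Cx R]_n) (phi : Cx R -> 'rV[Cx R]_n) : Prop :=
  forall z, unit_disc z -> derivable phi z 1 /\ Omega (phi z).

(* The infimum of the empty set is +oo. *)
Definition lempert_tilde (R : realType) (n : nat) (Omega : set 'rV[Cx R]_n)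
    (z w : 'rV[Cx R]_n) : \bar R :=
  ereal_inf [set (modulus a)%:E | a in
    [set a | unit_disc a /\ exists phi : Cx R -> 'rV[Cx R]_n,
       [/\ holomorphic_disc Omega phi, phi 0 = z & phi a = w]]].

(* The inverse of tanh on ]-1, 1[. *)
Definition artanh (R : realType) (x : R) : R := ln ((1 + x) / (1 - x)) / 2.

(* [lempert_tilde] takes its values in [0, 1[ or equals +oo, where [er_map]
   gives +oo. *)
Definition lempert (R : realType) (n : nat) (Omega : set 'rV[Cx R]_n)
    (z w : 'rV[Cx R]_n) : \bar R :=
  er_map (@artanh R) (lempert_tilde Omega z w).

Definition pseudodistance_on (R : realType) (T : Type) (A : set T)
    (d : T -> T -> R) : Prop :=
  [/\ forall x y, A x -> A y -> 0 <= d x y,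
      forall x, A x -> d x x = 0,
      forall x y, A x -> A y -> d x y = d y x &
      forall x y z, A x -> A y -> A z -> d x z <= d x y + d y z].

Definition distance_on (R : realType) (T : Type) (A : set T)
    (d : T -> T -> R) : Prop :=
  pseudodistance_on A d /\ forall x y, A x -> A y -> d x y = 0 -> x = y.

(* The largest pseudodistance below the Lempert function is the pointwise
   supremum of all of them; on a domain this supremum is finite. *)
Definition kobayashi (R : realType) (n : nat) (Omega : set 'rV[Cx R]_n)
    (z w : 'rV[Cx R]_n) : R :=
  sup [set d z w | d in
    [set d : 'rV[Cx R]_n -> 'rV[Cx R]_n -> R | pseudodistance_on Omega d /\
       forall x y, Omega x -> Omega y -> ((d x y)%:E <= lempert Omega x y)%E]].

Definition kobayashi_royden (R : realType) (n : nat) (Omega : set 'rV[Cx R]_n)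
    (z v : 'rV[Cx R]_n) : \bar R :=
  ereal_inf [set (modulus a)%:E | a in
    [set a : Cx R | exists phi : Cx R -> 'rV[Cx R]_n,
       [/\ holomorphic_disc Omega phi, phi 0 = z & a *: derive1 phi 0 = v]]].

Definition hyperbolic (R : realType) (n : nat) (Omega : set 'rV[Cx R]_n) : Prop :=
  distance_on Omega (kobayashi Omega).

Definition nbhs_infinity (R : realType) (n : nat) : set_system 'rV[Cx R]_n :=
  [set A | bounded_set (~` A)].

Definition hyperbolic_at (R : realType) (n : nat) (Omega : set 'rV[Cx R]_n)
    (p : 'rV[Cx R]_n) : Prop :=
  bounded_set Omega \/
  ~ bounded_set Omega /\
  (0 < limf_einf (fun zw : 'rV[Cx R]_n * 'rV[Cx R]_n => lempert Omega zw.1 zw.2)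
         (filter_prod (within Omega (nbhs p))
                      (within Omega (@nbhs_infinity R n))))%E.

Definition absolutely_continuous (R : realType) (a b : R) (f : R -> R) : Prop :=
  forall e : R, 0 < e -> exists2 d : R, 0 < d &
    forall s : seq (R * R),
      all (fun J => [&& a <= J.1, J.1 <= J.2 & J.2 <= b]) s ->
      pairwise (fun J K => (J.2 <= K.1) || (K.2 <= J.1)) s ->
      \sum_(J <- s) (J.2 - J.1) < d ->
      \sum_(J <- s) `|f J.2 - f J.1| < e.

Definition absolutely_continuous_curve (R : realType) (n : nat) (a b : R)
    (gamma : R -> 'rV[Cx R]_n) : Prop :=
  forall j : 'I_n,
    absolutely_continuous a b (fun t => complex.Re (gamma t 0 j)) /\
    absolutely_continuous a b (fun t => complex.Im (gamma t 0 j)).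

(* ['rV[Cx R]_n] is a normed module over [Cx R], not over [R], so the derivative
   in the real variable is taken on real and imaginary parts.  It is
   meaningful almost everywhere when [gamma] is absolutely continuous. *)
Definition curve_derivative (R : realType) (n : nat) (gamma : R -> 'rV[Cx R]_n)
    (t : R) : 'rV[Cx R]_n :=
  \row_j (Complex (derive1 (fun s : R => complex.Re (gamma s 0 j)) t)
                  (derive1 (fun s : R => complex.Im (gamma s 0 j)) t) : Cx R).

(* From here on [D] is an open set that may be disconnected: the metric objects
   are those of the component containing the point under consideration, which
   is [D] itself when [D] is connected. *)
Definition royden_length (R : realType) (n : nat) (D : set 'rV[Cx R]_n)
    (gamma : R -> 'rV[Cx R]_n) (a b : R) : \bar R :=
  (\int[lebesgue_measure]_(t in `[a, b])
     kobayashi_royden (connected_component D (gamma t))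
                      (gamma t) (curve_derivative gamma t))%E.

Definition geodesic (R : realType) (n : nat) (lambda eps : R)
    (D : set 'rV[Cx R]_n) (a b : R) (gamma : R -> 'rV[Cx R]_n) : Prop :=
  [/\ a <= b,
      forall t, a <= t <= b -> D (gamma t),
      absolutely_continuous_curve a b gamma &
      forall t1 t2, a <= t1 -> t1 <= t2 -> t2 <= b ->
        (royden_length D gamma t1 t2 <=
         (lambda * kobayashi (connected_component D (gamma t1))
                             (gamma t1) (gamma t2) + eps)%:E)%E].

Definition visible_point_eps (R : realType) (n : nat) (lambda eps : R)
    (D : set 'rV[Cx R]_n) (p : 'rV[Cx R]_n) : Prop :=
  forall U : set 'rV[Cx R]_n, neighbourhood p U -> bounded_set U ->
  exists V K : set 'rV[Cx R]_n,
    [/\ neighbourhood p V, relatively_compact_in V U, compact K, K `<=` D &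
        forall (a b : R) (gamma : R -> 'rV[Cx R]_n),
          geodesic lambda eps D a b gamma ->
          (D `&` V) (gamma a) -> (D `\` U) (gamma b) ->
          exists2 t, a <= t <= b & K (gamma t)].

Definition visible_point (R : realType) (n : nat) (lambda : R)
    (D : set 'rV[Cx R]_n) (p : 'rV[Cx R]_n) : Prop :=
  forall eps : R, 0 <= eps -> visible_point_eps lambda eps D p.

(* Main.v *)
(* The Kobayashi distance k is the infimum of the lengths of chains of discs;
   parametrising each disc of a chain by tanh gives curves along which the
   length dominates k, so a nearly minimal chain is a (1, eps)-geodesic.  Along
   such curves one never needs that k is bounded by the integral of the
   Kobayashi-Royden metric.

   Let D be the intersection of Omega with U.  If every disc of Omega centred at
   z maps the disc of radius tanh x into U, then at z the metric of D is at most
   coth x = 1 + O(exp (-2 x)) times that of Omega (Royden's localization).  Here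
   x may be any lower bound of k_Omega(z, Omega \ U), provided that it is bounded
   away from 0, which follows from hyperbolicity at p.  Visibility of p, for Omega
   or for D, gives k_Omega(z, Omega \ U) >= k_Omega(z, o) - C for z close to p and
   a base point o.  Hence the error made by localizing along a geodesic is the
   integral of a function decaying exponentially in k_Omega(., o), which is
   bounded uniformly.  So near p the distances k_D and k_Omega differ by a bounded
   amount on each component of D, and the geodesics of Omega and those of D
   coincide up to a change of eps; both implications follow by cutting a geodesic
   at its first exit from a small neighbourhood of p. *)

(* The two implications are not mirror images. To read a geodesic of D as one of Omega, lengths only
   shrink and the distances must be compared: k_D <= k_Omega + M on a component of D. The obstacle
   is that a nearly shortest chain of Omega between points near p may leave U; only its two ends,
   cut at a compact set, are then localized. To read a geodesic of Omega as one of D, distances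
   compare by monotonicity and the length must be localized. A geodesic carries an arbitrary
   parametrization and lambda may exceed 1, so time does not measure distance along it: the error is
   summed over levels of k_Omega(., o), whereas along chains, parametrized by hyperbolic length, it
   is summed over unit time steps. All estimates of distances use (1, 1)-visibility only, which
   follows from lambda-visibility since lambda >= 1. Hyperbolicity at p only bounds the discs
   centred near p. A Schwarz lemma turns the bound into smallness near the centre; the hyperbolicity
   of Omega provides it, through a ball contained in Omega. *)
Require Import Defs.
From mathcomp Require Import all_boot all_order all_algebra.
From mathcomp Require Import all_classical all_reals all_analysis.
From mathcomp Require Import complex ring lra measurable_realfun.
Import Order.TTheory GRing.Theory Num.Theory.
Import numFieldNormedType.Exports.
Import HBNNSimple.
Local Open Scope classical_set_scope.
Local Open Scope ring_scope.

Set Implicit Arguments.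
Unset Strict Implicit.
Unset Printing Implicit Defensive.

(** * Real-valued norms *)

Section RealNorm.
Context {R : realType}.

(* [r%:C] at type [Cx R], where the norm and the topology are found. *)
Definition rc (r : R) : Cx R := Complex r 0.

Lemma rcD (x y : R) : rc (x + y) = rc x + rc y.
Proof. exact: (rmorphD (real_complex R)). Qed.
Lemma rcN (x : R) : rc (- x) = - rc x.
Proof. exact: (rmorphN (real_complex R)). Qed.
Lemma rcB (x y : R) : rc (x - y) = rc x - rc y.
Proof. exact: (rmorphB (real_complex R)). Qed.
Lemma rcM (x y : R) : rc (x * y) = rc x * rc y.
Proof. exact: (rmorphM (real_complex R)). Qed.
Lemma rc1 : rc 1 = 1. Proof. by []. Qed.
Lemma rc0 : rc 0 = 0. Proof. by []. Qed.
Lemma rcV (x : R) : rc x^-1 = (rc x)^-1.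
Proof. exact: (fmorphV (real_complex R)). Qed.
Lemma ler_rc (x y : R) : (rc x <= rc y) = (x <= y).
Proof. exact: lecR. Qed.
Lemma ltr_rc (x y : R) : (rc x < rc y) = (x < y).
Proof. exact: ltcR. Qed.
Lemma rc_inj : injective rc.
Proof. by move=> x y []. Qed.

Lemma ge0_rc (a : Cx R) : 0 <= a -> a = rc (complex.Re a).
Proof. by case: a => a b /andP[/= /eqP -> _]. Qed.

Lemma gt0_rc (a : Cx R) : 0 < a -> a = rc (complex.Re a) /\ 0 < complex.Re a.
Proof. by case: a => a b /andP[/= /eqP -> ?]. Qed.

Section Mod.
Context {V : normedModType (Cx R)}.
Implicit Types x y : V.

Definition rnorm x : R := complex.Re `|x|.

Lemma rnormE x : `|x| = rc (rnorm x).
Proof. exact/ge0_rc/normr_ge0. Qed.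
Lemma rnorm_ge0 x : 0 <= rnorm x.
Proof. by rewrite -ler_rc -rnormE normr_ge0. Qed.
Lemma rnorm0 : rnorm 0 = 0.
Proof. by rewrite /rnorm normr0. Qed.
Lemma rnormN x : rnorm (- x) = rnorm x.
Proof. by rewrite /rnorm normrN. Qed.
Lemma rdistC x y : rnorm (x - y) = rnorm (y - x).
Proof. by rewrite /rnorm distrC. Qed.
Lemma rnormD x y : rnorm (x + y) <= rnorm x + rnorm y.
Proof. by rewrite -ler_rc rcD -!rnormE ler_normD. Qed.
Lemma rnormB x y : rnorm (x - y) <= rnorm x + rnorm y.
Proof. by rewrite -(rnormN y) rnormD. Qed.
Lemma rdistD z x y : rnorm (x - y) <= rnorm (x - z) + rnorm (z - y).
Proof. by rewrite (le_trans _ (rnormD _ _))// addrA subrK. Qed.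
Lemma rnorm_eq0 x : rnorm x = 0 -> x = 0.
Proof. by move=> x0; apply/eqP; rewrite -normr_eq0 rnormE x0. Qed.
Lemma rnorm_gt0 x : x != 0 -> 0 < rnorm x.
Proof.
by move=> x0; rewrite lt_neqAle rnorm_ge0 andbT eq_sym; apply: contra_neq x0; exact: rnorm_eq0.
Qed.

Lemma nbhs_rnormP x (A : set V) :
  nbhs x A <-> exists2 r : R, 0 < r & forall y, rnorm (y - x) < r -> A y.
Proof.
split.
  move=> /nbhs_normP[e /= /gt0_rc[eE e0] eA]; exists (complex.Re e) => // y yx.
  by apply: eA => /=; rewrite /= distrC rnormE eE ltr_rc.
move=> [r r0 rA]; apply/nbhs_normP; exists (rc r) => /=; first by rewrite ltr_rc.
by move=> y /=; rewrite distrC rnormE ltr_rc => /rA.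
Qed.

Definition rball x (r : R) : set V := [set y | rnorm (y - x) < r].

Lemma open_rball x r : open (rball x r).
Proof.
rewrite openE => y /= yx; apply/nbhs_rnormP; exists (r - rnorm (y - x)).
  by rewrite subr_gt0.
by move=> z zy; rewrite /rball /= (le_lt_trans (rdistD y _ _))// -ltrBrDr.
Qed.

Lemma open_rballP (A : set V) : open A -> forall x, A x ->
  exists2 r : R, 0 < r & rball x r `<=` A.
Proof.
rewrite openE => oA x /oA/nbhs_rnormP[r r0 h].
by exists r.
Qed.

Lemma rballP_open (A : set V) : (forall x, A x ->
  exists2 r : R, 0 < r & rball x r `<=` A) -> open A.
Proof. by move=> h; rewrite openE => x /h ?; exact/nbhs_rnormP. Qed.

Lemma rball_center x r : 0 < r -> rball x r x.
Proof. by rewrite /rball /= subrr rnorm0. Qed.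

Lemma closure_rball x (r : R) : closure (rball x r) `<=` [set y | rnorm (y - x) <= r].
Proof.
move=> y cy /=; apply/ler_addgt0Pr => e e0.
have [z [/= zx zy]] := cy (rball y e) (ltac:(by apply/nbhs_rnormP; exists e)).
by rewrite (le_trans (rdistD z _ _))// addrC lerD//; [exact: ltW | rewrite rdistC ltW].
Qed.

Lemma closureP (A : set V) y : closure A y <->
  forall e : R, 0 < e -> exists2 z, A z & rnorm (z - y) < e.
Proof.
split=> [cA e e0|h B /nbhs_rnormP[e e0 eB]].
  by have [z [Az zy]] := cA _ (ltac:(by apply/nbhs_rnormP; exists e) : nbhs y (rball y e)); exists z.
by have [z Az zy] := h _ e0; exists z; split => //; exact: eB.
Qed.

Lemma bounded_rnormP (A : set V) :
  bounded_set A <-> exists M : R, forall y, A y -> rnorm y <= M.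
Proof.
split.
  move=> /pinfty_ex_gt0[M /gt0_rc[ME M0] h]; exists (complex.Re M) => y Ay.
  by rewrite -ler_rc -rnormE -ME; exact: h.
move=> [M h]; exists (rc M); split; first by apply/complex_realP; exists M.
move=> N MN y Ay /=; rewrite rnormE (le_trans _ (ltW MN))// ler_rc; exact: h.
Qed.

End Mod.

Lemma normE (a : Cx R) : `|a| = rc (modulus a).
Proof. exact/ge0_rc/normr_ge0. Qed.

Lemma rnormZ (V : normedModType (Cx R)) (a : Cx R) (x : V) :
  rnorm (a *: x) = modulus a * rnorm x.
Proof. by apply: rc_inj; rewrite rcM -normE -!rnormE normrZ. Qed.

Lemma modulusE (a : Cx R) : modulus a = rnorm (a : (Cx R)^o). Proof. by []. Qed.

Lemma modulusM (a b : Cx R) : modulus (a * b) = modulus a * modulus b.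
Proof. by apply: rc_inj; rewrite rcM -!normE normrM. Qed.

Lemma modulusV (a : Cx R) : modulus a^-1 = (modulus a)^-1.
Proof. by apply: rc_inj; rewrite rcV -!normE normfV. Qed.

Lemma modulus_rc (r : R) : modulus (rc r) = `|r|.
Proof. by rewrite /modulus /= /= expr0n /= addr0 sqrtr_sqr. Qed.

Lemma modulus_ge0 (a : Cx R) : 0 <= modulus a.
Proof. exact: (@rnorm_ge0 (Cx R)^o). Qed.

Lemma modulus_gt0 (a : Cx R) : a != 0 -> 0 < modulus a.
Proof. exact: (@rnorm_gt0 (Cx R)^o). Qed.

Lemma modulus0 : modulus (0 : Cx R) = 0.
Proof. exact: (@rnorm0 (Cx R)^o). Qed.

Lemma modulusD (a b : Cx R) : modulus (a + b) <= modulus a + modulus b.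
Proof. exact: (@rnormD (Cx R)^o). Qed.

Lemma unit_discP (a : Cx R) : unit_disc a <-> modulus a < 1.
Proof. by rewrite /unit_disc /= normE -rc1 ltr_rc. Qed.

End RealNorm.

(** * The hyperbolic tangent and the automorphisms of the disc *)

Section Tanh.
Context {R : realType}.
Implicit Types u v : R.

(** The hyperbolic tangent, written with the single exponential exp (2 u) so that its identities
    become rational ones. *)
Definition th u : R := (expR (2 * u) - 1) / (expR (2 * u) + 1).

Lemma th0 : th 0 = 0.
Proof. by rewrite /th mulr0 expR0 subrr mul0r. Qed.

Lemma thN u : th (- u) = - th u.
Proof.
rewrite /th mulrN expRN; have := expR_gt0 (2 * u); set E := expR _ => E0.
by field; rewrite ?gt_eqF //; lra.
Qed.

Lemma th_lt1 u : th u < 1.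
Proof.
rewrite /th; have := expR_gt0 (2 * u); set E := expR _ => E0.
by rewrite ltr_pdivrMr ?mul1r; lra.
Qed.

Lemma th_gtN1 u : -1 < th u.
Proof. by have := th_lt1 (- u); rewrite thN ltrNl. Qed.

Lemma th_abs_lt1 u : `|th u| < 1.
Proof. by rewrite ltr_norml th_gtN1 th_lt1. Qed.

Lemma thD u v : th (u + v) = (th u + th v) / (1 + th u * th v).
Proof.
rewrite /th mulrDr expRD; have := expR_gt0 (2 * u); have := expR_gt0 (2 * v).
set E := expR _ => E0; set F := expR _ => F0.
have EF : 0 < E * F by rewrite mulr_gt0.
by field; rewrite ?gt_eqF //; nra.
Qed.

Lemma artanh_th u : artanh (th u) = u.
Proof.
rewrite /artanh /th; have := expR_gt0 (2 * u); set E := expR _ => E0.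
have -> : (1 + (E - 1) / (E + 1)) / (1 - (E - 1) / (E + 1)) = E.
  by field; rewrite ?gt_eqF //; lra.
by rewrite /E expRK mulrC mulrA mulVf ?mul1r.
Qed.

Lemma th_artanh (x : R) : -1 < x < 1 -> th (artanh x) = x.
Proof.
move=> /andP[x1 x2]; rewrite /th /artanh.
have -> : 2 * (ln ((1 + x) / (1 - x)) / 2) = ln ((1 + x) / (1 - x)) by field.
by rewrite lnK; [field; rewrite ?gt_eqF//; lra | rewrite posrE divr_gt0//; lra].
Qed.

Lemma is_derive_th u : is_derive u 1 th (1 - th u ^+ 2).
Proof.
pose f u := expR (2 * u) + 1.
have -> : th = (fun u => 1 - 2 * (f u)^-1).
  apply/funext => v; rewrite /th /f; have := expR_gt0 (2 * v); set E := expR _ => E0.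
  by field; rewrite ?gt_eqF //; lra.
have f0 : f u != 0 by rewrite gt_eqF// /f; have := expR_gt0 (2 * u); lra.
have df : is_derive u 1 f (2 * expR (2 * u)).
  rewrite /f; have -> : 2 * expR (2 * u) = (expR (2 * u) * (2 *: 1)) + 0 by rewrite addr0 scaler1 mulrC.
  apply: is_deriveD.
have dV := is_deriveV f0 df.
have -> : 1 - (1 - 2 * (f u)^-1) ^+ 2 = 0 - 2 *: (- f u ^- 2 *: (2 * expR (2 * u))).
  rewrite /GRing.scale /= ; have -> : expR (2 * u) = f u - 1 by rewrite /f addrK.
  by field.
apply: is_deriveB.
Qed.

Lemma th_lip u v : u <= v -> th v - th u <= v - u.
Proof.
move=> uv.
have ct : {within `[u, v], continuous th}.
  apply: continuous_subspaceT => x; apply: differentiable_continuous.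
  by apply/derivable1_diffP; case: (is_derive_th x).
have [c _ ->] := MVT_segment uv (fun x _ => is_derive_th x) ct.
by rewrite ler_piMl// ?subr_ge0// lerBlDr lerDl sqr_ge0.
Qed.

Lemma th_le u v : (th u <= th v) = (u <= v).
Proof.
rewrite /th; have := expR_gt0 (2 * u); have := expR_gt0 (2 * v).
rewrite -[u <= v](ler_pM2l (ltac:(lra) : 0 < (2:R))) -[2 * u <= _]ler_expR.
set E := expR _ => E0; set F := expR _ => F0.
rewrite ler_pdivrMr; last lra.
rewrite mulrAC ler_pdivlMr; last lra.
by apply/idP/idP; lra.
Qed.

Lemma th_lt u v : (th u < th v) = (u < v).
Proof. by rewrite !ltNge th_le. Qed.

Lemma th_ge0 u : (0 <= th u) = (0 <= u).
Proof. by rewrite -{1}th0 th_le. Qed.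

Lemma th_leid u : 0 <= u -> th u <= u.
Proof. by move=> /th_lip; rewrite th0 !subr0. Qed.

Lemma th_dist u v : `|th v - th u| <= `|v - u|.
Proof.
wlog uv : u v / u <= v => [h|].
  have [uv|/ltW vu] := leP u v; first exact: h.
  by rewrite distrC (distrC v); exact: h.
by rewrite !ger0_norm ?subr_ge0 ?th_le// th_lip.
Qed.

Lemma artanh_le (x y : R) : -1 < x -> x <= y -> y < 1 -> artanh x <= artanh y.
Proof.
move=> x1 xy y1; rewrite -th_le !th_artanh//; apply/andP; split; lra.
Qed.

Lemma artanh_ge0 (x : R) : 0 <= x -> x < 1 -> 0 <= artanh x.
Proof. by move=> x0 x1; rewrite -th_ge0 th_artanh// x1 andbT; lra. Qed.

(** Follows from ln (1 + y) <= y at y = 2 x / (1 - x). The bound is x + O(x^2), so nothing is lost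
    in the limit of fine subdivisions. *)
Lemma artanh_upper (x : R) : 0 <= x -> x < 1 -> artanh x <= x / (1 - x).
Proof.
move=> x0 x1; rewrite /artanh.
have -> : (1 + x) / (1 - x) = 1 + 2 * x / (1 - x) by field; rewrite gt_eqF//; lra.
have y0 : 0 <= x / (1 - x) by rewrite divr_ge0//; lra.
rewrite ler_pdivrMr// -mulrA [_ * 2]mulrC.
apply: le_trans (le_ln1Dx _) _ => //.
by rewrite (@lt_le_trans _ _ 0)// mulr_ge0.
Qed.

End Tanh.

Section Coord.
Context {R : realType} {n : nat}.

Lemma norm_coord (x : 'rV[Cx R]_n) (j : 'I_n) : modulus (x 0 j) <= rnorm x.
Proof.
rewrite -ler_rc -normE -rnormE [`|x|]mx_normE -[leLHS]nngE num_le.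
exact: (le_bigmax _ (fun i => `|x i.1 i.2|%:nng) (0, j)).
Qed.

Lemma Re_le_modulus (a : Cx R) : `|complex.Re a| <= modulus a.
Proof.
case: a => a b; rewrite /modulus /= -sqrtr_sqr ler_wsqrtr// lerDl sqr_ge0//.
Qed.

Lemma Im_le_modulus (a : Cx R) : `|complex.Im a| <= modulus a.
Proof.
case: a => a b; rewrite /modulus /= -(sqrtr_sqr b) ler_wsqrtr// lerDr sqr_ge0//.
Qed.

Lemma modulus_ltP (a : Cx R) : modulus a < 1 <-> complex.Re a ^+ 2 + complex.Im a ^+ 2 < 1.
Proof.
case: a => a b; rewrite /modulus /= -[X in _ < X]sqrtr1 ltr_sqrt//.
Qed.

End Coord.

Section Mobius.
Context {R : realType}.
Implicit Types (t : R) (z : Cx R).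

(** Real parameters suffice: chains run along the real diameter of each disc, on which
    [mobius (th u)] is the translation by u in hyperbolic arc length. *)
Definition mobius t z : Cx R := (z + rc t) / (1 + rc t * z).

Lemma mobius_denom t z : `|t| < 1 -> unit_disc z -> 1 + rc t * z != 0.
Proof.
move=> t1 /unit_discP z1; apply/negP => /eqP /addr0_eq h.
have : modulus (rc t * z) = 1 by rewrite -h -rc1 -rcN modulus_rc normrN1.
have : `|t| * modulus z < 1 by apply: mulr_ilt1 => //; exact: modulus_ge0.
by rewrite modulusM modulus_rc => + h1; rewrite h1 ltxx.
Qed.

Lemma mobius_disc t z : `|t| < 1 -> unit_disc z -> unit_disc (mobius t z).
Proof.
move=> t1 z1; have d0 := mobius_denom t1 z1.
apply/unit_discP; rewrite /mobius modulusM modulusV ltr_pdivrMr; last first.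
  by rewrite modulus_gt0.
rewrite mul1r; case: z {d0} z1 => a b /unit_discP/modulus_ltP /= ab.
have t2 : t ^+ 2 < 1 by rewrite -real_normK ?num_real// expr_lt1.
rewrite /modulus /= ltr_sqrt.
  by rewrite !mul0r !subr0 !addr0 !add0r; nra.
rewrite !mul0r !subr0 !addr0 !add0r.
(* With z = a + i b, this product is |1 + t z|^2 - |z + t|^2. *)
have : 0 < (1 - t ^+ 2) * (1 - (a ^+ 2 + b ^+ 2)) by rewrite mulr_gt0 ?subr_gt0.
by have := sqr_ge0 (a + t); have := sqr_ge0 b; nra.
Qed.

Lemma mobius0 t : mobius t 0 = rc t.
Proof. by rewrite /mobius mulr0 add0r addr0 divr1. Qed.

Lemma mobius_th u v : mobius (th u) (rc (th v)) = rc (th (v + u)).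
Proof.
by rewrite /mobius thD rcM rcV !rcD rcM rc1 [rc (th u) * _]mulrC.
Qed.

Lemma is_derive_mulc (a z : Cx R) : is_derive z 1 (fun z => a * z) a.
Proof.
have h : is_derive z 1 (a \*: (id : Cx R -> Cx R)) (a *: 1) by exact: is_deriveZ.
by rewrite -[X in is_derive _ _ _ X]mulr1.
Qed.

Lemma derivable_mulc (a z : Cx R) : derivable (fun z => a * z) z 1.
Proof. by have [h _] := is_derive_mulc a z; exact: h. Qed.

Lemma derive1_mulc (a z : Cx R) : derive1 (fun z => a * z) z = a.
Proof. by have [_ h] := is_derive_mulc a z; rewrite derive1E; exact: h. Qed.

Lemma is_derive_mobius t z : `|t| < 1 -> unit_disc z ->
  is_derive z 1 (mobius t) ((1 - rc t ^+ 2) / (1 + rc t * z) ^+ 2).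
Proof.
move=> t1 z1; have d0 := mobius_denom t1 z1.
have dn : is_derive z 1 (fun z : Cx R => z + rc t) 1.
  by rewrite -[X in is_derive _ _ _ X]addr0; apply: is_deriveD.
have dd : is_derive z 1 (fun z : Cx R => 1 + rc t * z) (rc t).
  rewrite -[X in is_derive _ _ _ X]add0r.
  by apply: is_deriveD; exact: is_derive_mulc.
have dv : is_derive z 1 (fun z : Cx R => (1 + rc t * z)^-1) (- (1 + rc t * z) ^- 2 * rc t).
  have [dd1 dd2] := dd; apply: DeriveDef; first exact: derivableV.
  by rewrite deriveV// dd2.
have := is_deriveM dn dv; congr (is_derive _ _ _ _).
by rewrite /GRing.scale /=; field.
Qed.

Lemma derivable_mobius t z : `|t| < 1 -> unit_disc z -> derivable (mobius t) z 1.
Proof. by move=> t1 z1; have [h _] := is_derive_mobius t1 z1; exact: h. Qed.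

Lemma derive1_mobius0 t : `|t| < 1 -> derive1 (mobius t) 0 = rc (1 - t ^+ 2).
Proof.
move=> t1; have z1 : unit_disc (0 : Cx R) by rewrite /unit_disc /= normr0 ltr01.
have [_ h] := is_derive_mobius t1 z1.
rewrite derive1E; apply: etrans h _; rewrite mulr0 addr0 expr1n divr1.
by rewrite rcB !expr2 rcM.
Qed.

End Mobius.

Section Comp.
Context {R : realType} {n : nat}.
Implicit Types (phi : Cx R -> 'rV[Cx R]_n) (m : Cx R -> Cx R).

Lemma is_derive_comp phi m z : derivable m z 1 -> derivable phi (m z) 1 ->
  is_derive z 1 (phi \o m) (derive1 m z *: derive1 phi (m z)).
Proof.
move=> /derivable1_diffP dm /derivable1_diffP dphi.
have dc := differentiable_comp dm dphi.
apply: DeriveDef; first exact/derivable1_diffP.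
rewrite -derive1E (derive1E' dc) (diff_comp dm dphi) (derive1E' dm) (derive1E' dphi) /=.
have h : scalable ('d phi (m z)) by move=> a x; rewrite linearZ.
have := h ('d m z 1) 1; rewrite [_ *: 1]mulr1; exact.
Qed.

Lemma derivable_comp phi m z : derivable m z 1 -> derivable phi (m z) 1 ->
  derivable (phi \o m) z 1.
Proof. by move=> dm dphi; have [d _] := is_derive_comp dm dphi; exact: d. Qed.

Lemma derive1_comp_disc phi m z : derivable m z 1 -> derivable phi (m z) 1 ->
  derive1 (phi \o m) z = derive1 m z *: derive1 phi (m z).
Proof. by move=> dm dphi; have [_ d] := is_derive_comp dm dphi; rewrite derive1E; exact: d. Qed.

Lemma derive_eps phi z : derivable phi z 1 -> forall e : R, 0 < e ->
  exists2 d : R, 0 < d & forall h, modulus h < d ->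
    rnorm (phi (z + h) - phi z - h *: derive1 phi z) <= e * modulus h.
Proof.
move=> df e e0; have /cvgrPdist_le/(_ (rc e)) := df.
rewrite ltr_rc => /(_ e0)/nbhs_rnormP[d d0 dh]; exists d => // h hd.
have [->|h0] := eqVneq h 0.
  by rewrite addr0 scale0r !subrr rnorm0; apply: mulr_ge0; [exact: ltW|exact: modulus_ge0].
have := dh h; rewrite subr0 => /(_ hd h0).
rewrite rnormE ler_rc /= [h *: 1]mulr1 -[lim _]/('D_1 phi z) -derive1E => he.
rewrite mulrC -ler_pdivrMl; last by rewrite modulus_gt0.
rewrite -modulusV -rnormZ scalerBr scalerA mulVf// scale1r rdistC.
by rewrite (addrC z).
Qed.

End Comp.


(** * Chains of discs *)

Section Discs.
Context {R : realType} {n : nat}.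
Local Notation E := 'rV[Cx R]_n.
Implicit Types (G : set E) (phi : Cx R -> E) (x y : E).

Lemma disc0 : unit_disc (0 : Cx R).
Proof. by rewrite /unit_disc /= normr0 ltr01. Qed.

Lemma disc_rc (r : R) : `|r| < 1 -> unit_disc (rc r).
Proof. by move=> r1; apply/unit_discP; rewrite modulus_rc. Qed.

Lemma disc_th (u : R) : unit_disc (rc (th u)).
Proof. exact/disc_rc/th_abs_lt1. Qed.

Lemma holo_mono G G' phi : G `<=` G' -> holomorphic_disc G phi -> holomorphic_disc G' phi.
Proof. by move=> GG h z /h[? /GG]. Qed.

(** The competitors for both metrics are centred at 0. Moebius translation recentres a disc at any
    point of its real diameter and only shifts the time of its parametrization by [th]. *)
Lemma holo_shift G phi (u : R) : holomorphic_disc G phi ->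
  exists psi, [/\ holomorphic_disc G psi,
    forall v, psi (rc (th v)) = phi (rc (th (v + u))),
    psi 0 = phi (rc (th u)) &
    derive1 psi 0 = rc (1 - th u ^+ 2) *: derive1 phi (rc (th u))].
Proof.
move=> hphi; have u1 := th_abs_lt1 u.
exists (phi \o mobius (th u)); split => /=.
- move=> z z1; have mz := mobius_disc u1 z1; have [dphi Gphi] := hphi _ mz.
  by split; [exact: (derivable_comp (derivable_mobius u1 z1) dphi) | exact: Gphi].
- by move=> v; rewrite mobius_th.
- by rewrite mobius0.
- have [dphi _] := hphi _ (mobius_disc u1 disc0).
  have := derive1_comp_disc (derivable_mobius u1 disc0) dphi.
  by rewrite (derive1_mobius0 u1) mobius0.
Qed.

Lemma holo_rot G phi (a : Cx R) : holomorphic_disc G phi -> modulus a <= 1 ->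
  holomorphic_disc G (fun z => phi (a * z)) /\
  derive1 (fun z => phi (a * z)) 0 = a *: derive1 phi 0.
Proof.
move=> hphi a1; split.
  move=> z z1; have az : unit_disc (a * z).
    apply/unit_discP; rewrite modulusM; move/unit_discP: z1; apply: le_lt_trans.
    by rewrite ler_piMl// modulus_ge0.
  have [dphi Gphi] := hphi _ az.
  by split; [exact: (derivable_comp (@derivable_mulc _ a z) dphi) | exact: Gphi].
have [d0 _] := hphi _ disc0; rewrite -(mulr0 a) in d0.
have := derive1_comp_disc (@derivable_mulc _ a 0) d0.
by rewrite derive1_mulc mulr0.
Qed.

Lemma holo_zoom G G' phi (r : R) : holomorphic_disc G phi -> 0 < r <= 1 ->
  (forall z, modulus z < r -> G' (phi z)) ->
  holomorphic_disc G' (fun z => phi (rc r * z)) /\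
  derive1 (fun z => phi (rc r * z)) 0 = rc r *: derive1 phi 0.
Proof.
move=> hphi /andP[r0 r1] hr.
have [h1 h2] := @holo_rot _ _ (rc r) hphi (ltac:(by rewrite modulus_rc gtr0_norm)).
split=> // z z1; split; first by case: (h1 _ z1).
apply: hr; rewrite modulusM modulus_rc gtr0_norm//.
by rewrite -[ltRHS]mulr1 ltr_pM2l//; exact/unit_discP.
Qed.

Lemma holo_affine G G' phi (c : Cx R) x : holomorphic_disc G phi ->
  (forall z, unit_disc z -> G' (x + c *: phi z)) ->
  holomorphic_disc G' (fun z => x + c *: phi z).
Proof.
move=> h h' z z1; split; last exact: h'.
have [d _] := h _ z1; apply: derivableD; first exact: derivable_cst.
exact: derivableZ d.
Qed.

Lemma holo_line G x (v : E) :
  (forall z, unit_disc z -> G (x + z *: v)) ->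
  holomorphic_disc G (fun z => x + z *: v) /\ derive1 (fun z => x + z *: v) 0 = v.
Proof.
move=> h.
have l : linear (fun z : Cx R => z *: v : E).
  by move=> a b c; rewrite scalerDl scalerA.
have dv z : is_derive z (1 : Cx R) (fun z : Cx R => x + z *: v) v.
  have dv : (fun h => h^-1 *: (((fun z => x + z *: v) \o shift z) (h *: 1) - (x + z *: v))) @
      (0 : Cx R)^' --> v.
    apply/cvgrPdist_le => e e0; apply/nbhs_rnormP; exists 1 => // k _ k0.
    rewrite /= scalerDl [k *: 1]mulr1 opprD addrACA subrr add0r addrK scalerA mulVf//.
    by rewrite scale1r subrr normr0 ltW.
  by apply: DeriveDef; [apply/cvg_ex; exists v; exact: dv | exact: (cvg_lim _ dv)].
split; last by rewrite derive1E; have [_ h0] := dv 0; exact: h0.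
by move=> z z1; split; [have [h1 _] := dv z; exact: h1| exact: h].
Qed.

(* A curve made of finitely many discs [phi] composed with [tanh], that is,
   parametrised by the hyperbolic arc length of the discs. *)
Inductive dpath G (g : R -> E) : R -> R -> Prop :=
| dpath_disc a b c phi of a <= b & holomorphic_disc G phi &
    (forall t, a <= t <= b -> g t = phi (rc (th (t - c)))) : dpath G g a b
| dpath_cat a b c of dpath G g a b & dpath G g b c : dpath G g a c.

Lemma dpath_le G g a b : dpath G g a b -> a <= b.
Proof. by elim=> // {}a {}b c _ ab _; exact: le_trans. Qed.

Lemma dpath_in G g a b : dpath G g a b -> forall t, a <= t <= b -> G (g t).
Proof.
elim=> [{}a {}b c phi ab h gE t /gE -> |{}a {}b c _ hab _ hbc t /andP[at_ tc]].
  by case: (h _ (disc_th (t - c))).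
have [tb|/ltW bt] := leP t b; first by apply: hab; rewrite at_.
by apply: hbc; rewrite bt.
Qed.

(** The offset c in [dpath_disc] is free, so a disc can be cut at any time without being
    reparametrized. *)
Lemma dpath_sub G g a b : dpath G g a b ->
  forall s t, a <= s -> s <= t -> t <= b -> dpath G g s t.
Proof.
elim=> [{}a {}b c phi ab h gE s t as_ st tb |{}a {}b c _ hab _ hbc s t as_ st tc].
  apply: (@dpath_disc _ _ _ _ c phi) => // u /andP[su ut]; apply: gE.
  by rewrite (le_trans as_)//= (le_trans ut).
have [tb|/ltW bt] := leP t b; first exact: hab.
have [sb|/ltW bs] := leP s b; last exact: hbc.
by apply: dpath_cat (hab _ _ as_ sb (lexx _)) (hbc _ _ (lexx _) bt tc).
Qed.

Lemma dpath_ext G g g' a b : dpath G g a b ->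
  (forall t, a <= t <= b -> g' t = g t) -> dpath G g' a b.
Proof.
elim=> [{}a {}b c phi ab h gE g'E |{}a {}b c dab hab dbc hbc g'E].
  apply: (@dpath_disc _ _ _ _ c phi) => // t tab; rewrite g'E//; exact: gE.
have ab := dpath_le dab; have bc := dpath_le dbc.
apply: dpath_cat.
  by apply: hab => t /andP[? tb]; apply: g'E; apply/andP; split => //; exact: le_trans tb _.
by apply: hbc => t /andP[bt ?]; apply: g'E; apply/andP; split => //; exact: le_trans bt.
Qed.

Lemma dpath_mono G G' g a b : G `<=` G' -> dpath G g a b -> dpath G' g a b.
Proof.
move=> GG; elim=> [{}a {}b c phi ab h gE|{}a {}b c _ + _ ]; last exact: dpath_cat.
by apply: (@dpath_disc _ _ _ _ c phi) => //; exact: holo_mono h.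
Qed.

Lemma dpath_shift G g a b d : dpath G g a b -> dpath G (fun t => g (t - d)) (a + d) (b + d).
Proof.
elim=> [{}a {}b c phi ab h gE|{}a {}b c _ + _ ]; last exact: dpath_cat.
apply: (@dpath_disc _ _ _ _ (c + d) phi) => //; first by rewrite lerD2r.
move=> t tab; rewrite gE; first by congr (phi (rc (th _))); ring.
by rewrite lerBrDr lerBlDr.
Qed.

Lemma dpath_rev G g a b : dpath G g a b -> dpath G (fun t => g (- t)) (- b) (- a).
Proof.
elim=> [{}a {}b c phi ab h gE|{}a {}b c _ + _ ]; last by move=> ? ?; apply: dpath_cat; eassumption.
have [h' _] := @holo_rot _ _ (rc (-1)) h (ltac:(by rewrite modulus_rc normrN1)).
apply: (@dpath_disc _ _ _ _ (- c) (fun z => phi (rc (-1) * z))) => //; first by rewrite lerN2.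
move=> t /andP[bt ta]; rewrite gE; last by rewrite lerNr ta lerNl.
by rewrite -rcM mulN1r -thN; congr (phi (rc (th _))); ring.
Qed.

Lemma dpath_map (f : E -> E) G G' g a b :
  (forall phi, holomorphic_disc G phi -> holomorphic_disc G' (f \o phi)) ->
  dpath G g a b -> dpath G' (f \o g) a b.
Proof.
move=> hf; elim=> [{}a {}b c phi ab h gE|{}a {}b c _ + _ ]; last exact: dpath_cat.
apply: (@dpath_disc _ _ _ _ c (f \o phi)) => //; first exact: hf.
by move=> t tab /=; rewrite gE.
Qed.

(** The number s is the hyperbolic length of a chain; it is additive under concatenation, which the
    Lempert function is not. *)
Definition reach G x y (s : R) := exists g, [/\ dpath G g 0 s, g 0 = x & g s = y].

Lemma reach_ge0 G x y s : reach G x y s -> 0 <= s.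
Proof. by move=> [g [/dpath_le]]. Qed.

Lemma dpath_reach G g a b : dpath G g a b -> reach G (g a) (g b) (b - a).
Proof.
move=> /(@dpath_shift _ _ _ _ (- a)); rewrite subrr => h.
by exists (fun t => g (t - - a)); split => //; congr g; ring.
Qed.

Lemma reachP G x y s : reach G x y s -> forall a,
  exists g, [/\ dpath G g a (s + a), g a = x & g (s + a) = y].
Proof.
move=> [g [dg g0 gs]] a; exists (fun t => g (t - a)); split.
- by have := dpath_shift a dg; rewrite add0r.
- by rewrite subrr.
- by rewrite addrK.
Qed.

Lemma reach_in G x y s : reach G x y s -> G x /\ G y.
Proof.
move=> [g [dg <- <-]]; have s0 := dpath_le dg.
by split; apply: (dpath_in dg); rewrite lexx ?s0.
Qed.

Lemma reach_sym G x y s : reach G x y s -> reach G y x s.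
Proof.
move=> [g [/dpath_rev/dpath_reach + g0 gs]].
by rewrite /= oppr0 !opprK oppr0 g0 gs add0r.
Qed.

Lemma reach_refl G x : G x -> reach G x x 0.
Proof.
move=> Gx; exists (fun=> x); split => //.
apply: (@dpath_disc _ _ _ _ 0 (fun=> x)) => // z _; split => //; exact: derivable_cst.
Qed.

Lemma reach_trans G y x z s t : reach G x y s -> reach G y z t -> reach G x z (s + t).
Proof.
move=> [g [dg gx gy]] /reachP/(_ s)[h [dh hy hz]].
have s0 := dpath_le dg; have t0 := dpath_le dh.
exists (fun u => if u <= s then g u else h u); split; last 2 first.
- by rewrite s0.
- case: ifP => [ts|]; last by rewrite addrC.
  have t00 : t = 0 by apply/eqP; rewrite eq_le; apply/andP; split; lra.
  by move: hz; rewrite t00 addr0 add0r gy hy.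
rewrite addrC; apply: (@dpath_cat _ _ _ s).
  by apply: dpath_ext dg _ => u /andP[_ ->].
apply: dpath_ext dh _ => u /andP[su _]; case: ifP => // us.
by have -> : u = s by [apply/eqP; rewrite eq_le us]; rewrite gy.
Qed.

Lemma reach_mono G G' x y s : G `<=` G' -> reach G x y s -> reach G' x y s.
Proof. by move=> GG [g [dg ? ?]]; exists g; split => //; exact: dpath_mono dg. Qed.

Lemma reach_th G phi (u v : R) : holomorphic_disc G phi ->
  reach G (phi (rc (th u))) (phi (rc (th v))) `|u - v|.
Proof.
move=> h; wlog uv : u v / u <= v => [hw|].
  have [|/ltW] := leP u v; first exact: hw.
  by rewrite distrC => /hw/reach_sym.
rewrite distrC ger0_norm ?subr_ge0//.
have := @dpath_reach G (fun t => phi (rc (th (t - 0)))) u v.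
rewrite !subr0; apply.
by apply: (@dpath_disc _ _ _ _ 0 phi).
Qed.

Lemma reach_holo G phi (a : Cx R) : holomorphic_disc G phi -> unit_disc a ->
  reach G (phi 0) (phi a) (artanh (modulus a)).
Proof.
move=> h a1; have [a0|a0] := eqVneq a 0.
  rewrite a0 modulus0 /artanh subr0 addr0 divr1 ln1 mul0r.
  by apply: reach_refl; case: (h _ disc0).
have m0 : 0 < modulus a by rewrite modulus_gt0.
have m1 : modulus a < 1 by apply/unit_discP.
(* A rotation brings a to the positive real axis, where it is [th] of the required length. *)
have [] := @holo_rot G phi (a / rc (modulus a)) h.
  by rewrite modulusM modulusV modulus_rc gtr0_norm// divff// gt_eqF.
move=> /(@reach_th _ _ 0 (artanh (modulus a))) + _.
rewrite th0 sub0r normrN ger0_norm ?artanh_ge0// ?ltW// mulr0.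
rewrite th_artanh ?m1 ?andbT ?divfK//; last by rewrite (lt_trans _ m0)// ltrN10.
by apply/negP => /eqP/rc_inj m00; rewrite m00 ltxx in m0.
Qed.

Lemma reach_local G x y (r : R) : 0 < r -> rball x r `<=` G -> rnorm (y - x) < r ->
  reach G x y (artanh (rnorm (y - x) / r)).
Proof.
move=> r0 xG yx; have [->|y0] := eqVneq y x.
  rewrite subrr rnorm0 mul0r /artanh subr0 addr0 divr1 ln1 mul0r.
  by apply: reach_refl; apply: xG; exact: rball_center.
have n0 : 0 < rnorm (y - x) by rewrite rnorm_gt0// subr_eq0.
pose v := rc (r / rnorm (y - x)) *: (y - x).
have rv : rnorm v = r by rewrite rnormZ modulus_rc gtr0_norm ?divr_gt0// divfK// gt_eqF.
have [] := @holo_line G x v.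
  move=> z /unit_discP z1; apply: xG; rewrite /rball /= addrC addKr rnormZ rv.
  by rewrite -[ltRHS]mul1r ltr_pM2r.
move=> /(@reach_holo _ _ (rc (rnorm (y - x) / r))) h _.
have := h; rewrite modulus_rc gtr0_norm ?divr_gt0// scale0r addr0 scalerA -rcM.
rewrite mulrA divfK ?gt_eqF// divff ?gt_eqF// scale1r (addrC x) subrK; apply.
by apply: disc_rc; rewrite gtr0_norm ?divr_gt0// ltr_pdivrMr// mul1r.
Qed.

End Discs.


(** * Connectedness and compactness *)

Section Topo.
Context {R : realType}.

(** Only local boundedness is asked. For functions built from Kobayashi distances the triangle
    inequality gives it directly, even if they jump between components. *)
Lemma compact_bound (T : topologicalType) (K : set T) (f : T -> R) : compact K ->
  (forall x, K x -> exists M, \forall y \near x, f y <= M) ->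
  exists M, forall x, K x -> f x <= M.
Proof.
move=> /compact_near_coveringP/(_ R (+oo) (fun M x => f x <= M)) h lb.
have [|M [_]] := h _.
  move=> x /lb[M fM]; exists ([set y | f y <= M], [set i | M < i]).
    by split; [exact: fM | exact: nbhs_pinfty_gt (num_real M)].
  by move=> [y i] [/= fy Mi]; exact: le_trans fy (ltW Mi).
move=> h'; exists (M + 1); apply: h'; rewrite ltrDl ltr01//.
Qed.

Lemma cts_rnormP (V : normedModType (Cx R)) (f : R -> V) :
  (forall (t e : R), 0 < e -> exists2 d : R, 0 < d &
     forall s, `|s - t| < d -> rnorm (f s - f t) < e) -> continuous f.
Proof.
move=> h t; apply/cvgrPdist_lt => e /gt0_rc[-> e0].
have [d d0 hd] := h t _ e0; apply/nbhs_ballP; exists d => // s.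
by rewrite /ball /= distrC => /hd; rewrite distrC rnormE ltr_rc.
Qed.

Lemma starlike_connected (V : normedModType (Cx R)) (A : set V) x :
  A x -> (forall y t, A y -> 0 <= t <= 1 -> A (x + rc t *: (y - x))) -> connected A.
Proof.
move=> Ax hA; pose S y := (fun t : R => x + rc t *: (y - x)) @` `[0, 1].
have -> : A = \bigcup_(y in A) S y.
  apply/seteqP; split => [y Ay|_ [y Ay [t t01 <-]]]; last first.
    by apply: hA => //; move: t01; rewrite /= in_itv.
  exists y => //; exists 1; first by rewrite /= in_itv /= ler01 lexx.
  by rewrite rc1 scale1r addrC subrK.
apply: bigcup_connected.
  exists x => y _; exists 0; first by rewrite /= in_itv /= ler01 lexx.
  by rewrite rc0 scale0r addr0.
move=> y _; apply: connected_continuous_connected; first exact: segment_connected.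
apply: continuous_subspaceT; apply: cts_rnormP => t e e0.
have r0 : 0 < rnorm (y - x) + 1 by rewrite ltr_wpDl// rnorm_ge0.
exists (e / (rnorm (y - x) + 1)); first by rewrite divr_gt0.
move=> s; rewrite ltr_pdivlMr// => st.
rewrite opprD addrACA subrr add0r -scalerBl -rcB rnormZ modulus_rc.
by apply: le_lt_trans st; rewrite ler_wpM2l// lerDl.
Qed.

Lemma connected_rball (V : normedModType (Cx R)) (x : V) (r : R) : 0 < r -> connected (rball x r).
Proof.
move=> r0; apply: (@starlike_connected _ _ x); first exact: rball_center.
move=> y t; rewrite /rball /= => yx /andP[t0 t1].
rewrite addrC addKr rnormZ modulus_rc ger0_norm//.
by rewrite (le_lt_trans _ yx)// ler_piMl// rnorm_ge0.
Qed.

Lemma connected_disc : connected (@unit_disc R).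
Proof.
have -> : @unit_disc R = rball (0 : Cx R) 1.
  by apply/seteqP; split => z; rewrite /rball /= subr0 => /unit_discP.
by apply: connected_rball; rewrite ltr01.
Qed.

Lemma open_component (V : normedModType (Cx R)) (D : set V) x : open D ->
  open (connected_component D x).
Proof.
move=> oD; apply: rballP_open => y Dy.
have [r r0 rD] := open_rballP oD (@connected_component_sub _ _ _ _ Dy).
exists r => //; rewrite (same_connected_component Dy).
by apply: connected_component_max => //; [exact: rball_center|exact: connected_rball].
Qed.

Lemma closed_le_rnorm (V : normedModType (Cx R)) (x : V) (r : R) :
  closed [set y | rnorm (y - x) <= r].
Proof.
move=> y /closureP cy /=; apply/ler_addgt0Pr => e /cy[z /= zx zy].
by rewrite (le_trans (rdistD z _ _))// addrC lerD// rdistC ltW.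
Qed.

Lemma compact_le_modulus (a : Cx R) (r : R) : compact [set z : Cx R | modulus (z - a) <= r].
Proof.
pose f (xy : R * R) : Cx R := a + Complex xy.1 xy.2.
have cf : continuous f.
  move=> xy; apply/cvgrPdist_lt => e /gt0_rc[-> e0].
  have e2 : 0 < complex.Re e / 2 by rewrite divr_gt0.
  exists (ball xy.1 (complex.Re e / 2), ball xy.2 (complex.Re e / 2)).
    by split; exact: nbhsx_ballx.
  move=> uv [/= b1 b2]; rewrite /f opprD addrACA subrr add0r normE ltr_rc.
  have -> : Complex xy.1 xy.2 - Complex uv.1 uv.2 =
    rc (xy.1 - uv.1) + Complex 0 1 * rc (xy.2 - uv.2) :> Cx R.
    by apply/eqP; rewrite eq_complex /=; apply/andP; split; apply/eqP; ring.
  apply: (le_lt_trans (modulusD _ _)); rewrite modulusM !modulus_rc.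
  have -> : modulus (Complex 0 1 : Cx R) = 1.
    by rewrite /modulus /= expr0n /= add0r expr1n sqrtr1.
  by rewrite mul1r [ltRHS](splitr (complex.Re e)) ltrD.
have cK : compact (f @` (`[- r, r] `*` `[- r, r])).
  apply: continuous_compact; first exact: continuous_subspaceT.
  by apply: compact_setX; exact: segment_compact.
apply: subclosed_compact cK _; first exact: (@closed_le_rnorm (Cx R) a r).
move=> z /= za; exists (complex.Re (z - a), complex.Im (z - a)).
  split; rewrite /= in_itv /=; rewrite -ler_norml.
    exact: le_trans (Re_le_modulus _) za.
  exact: le_trans (Im_le_modulus _) za.
rewrite /f /=; have -> : forall w : Cx R, Complex (complex.Re w) (complex.Im w) = w by case.
by rewrite addrC subrK.
Qed.

Lemma compact_le_rnorm n (x : 'rV[Cx R]_n) (r : R) : compact [set y | rnorm (y - x) <= r].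
Proof.
have cK : compact [set v : 'rV[Cx R]_n | forall i, [set z : Cx R | modulus (z - x 0 i) <= r] (v 0 i)].
  apply: (@rV_compact (Cx R) n (fun i => [set z : Cx R | modulus (z - x 0 i) <= r])).
  by move=> i; exact: compact_le_modulus.
apply: subclosed_compact cK _; first exact: closed_le_rnorm.
move=> v /= vx i; apply: le_trans vx.
by have := norm_coord (v - x) i; rewrite !mxE.
Qed.

End Topo.


(** * The Kobayashi distance as an infimum over chains *)

Section Kobayashi.
Context {R : realType} {n : nat}.
Local Notation E := 'rV[Cx R]_n.
Implicit Types (G : set E) (phi : Cx R -> E) (x y : E).

(** The set B of points reached from x is open and closed in G, because one affine disc joins the
    centre of a ball of G to any other of its points. *)
Lemma reach_ex G x y : open G -> connected G -> G x -> G y -> exists s, reach G x y s.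
Proof.
move=> oG cG Gx Gy; pose B := [set y | exists s, reach G x y s].
suff : B = G by move=> BG; have : B y by rewrite BG.
have loc u v (r : R) : 0 < r -> rball u r `<=` G -> rball u r v ->
    exists s, reach G u v s.
  by move=> r0 rG uv; exists (artanh (rnorm (v - u) / r)); exact: reach_local rG _.
have BG : B `<=` G by move=> v [s xv]; case: (reach_in xv).
apply: cG.
- by exists x; exists 0; exact: reach_refl.
- exists B; last by apply/seteqP; split => v; [move=> Bv; split => //; exact: BG| case].
  apply: rballP_open => v [s xv].
  have [r r0 rG] := open_rballP oG (reach_in xv).2; exists r => // w vw.
  have [t vw'] := loc _ _ _ r0 rG vw; exists (s + t); exact: reach_trans xv vw'.
- exists (~` (G `\` B)); last first.
    by apply/seteqP; split => v; [move=> Bv; split; [exact: BG|case] | move=> [Gv] /not_andP[//|/contrapT]].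
  apply: open_closedC; apply: rballP_open => v [Gv Bv].
  have [r r0 rG] := open_rballP oG Gv; exists r => // w vw; split; first exact: rG.
  move=> [s xw]; apply: Bv; have [t vw'] := loc _ _ _ r0 rG vw.
  by exists (s + t); exact: reach_trans xw (reach_sym vw').
Qed.

Definition creach G x y : R := inf [set s | reach G x y s].

Section Domain.
Variable G : set E.
Hypotheses (oG : open G) (cG : connected G).

Let has_inf_reach x y : G x -> G y -> has_inf [set s | reach G x y s].
Proof.
move=> Gx Gy; split; first exact: reach_ex.
by exists 0 => s /reach_ge0.
Qed.

Lemma creach_le x y s : reach G x y s -> creach G x y <= s.
Proof. by move=> h; apply: ge_inf => //; exists 0 => t /reach_ge0. Qed.

Lemma creach_lt x y (e : R) : G x -> G y -> 0 < e ->
  exists2 s, reach G x y s & s < creach G x y + e.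
Proof. by move=> Gx Gy e0; exact: (inf_adherent e0 (has_inf_reach Gx Gy)). Qed.

Lemma pseudodistance_creach : pseudodistance_on G (creach G).
Proof.
have ge0 x y : G x -> G y -> 0 <= creach G x y.
  move=> Gx Gy; apply: lb_le_inf; first exact: reach_ex.
  by move=> s /reach_ge0.
have le_sym x y : G x -> G y -> creach G x y <= creach G y x.
  move=> Gx Gy; apply: lb_le_inf; first exact: reach_ex.
  by move=> s /reach_sym/creach_le.
split => //.
- move=> x Gx; apply/eqP; rewrite eq_le ge0// andbT; apply: creach_le; exact: reach_refl.
- by move=> x y Gx Gy; apply/eqP; rewrite eq_le !le_sym.
- move=> x y z Gx Gy Gz; apply/ler_addgt0Pr => e e0.
  have e2 : 0 < e / 2 by rewrite divr_gt0.
  have [s xs sE] := creach_lt Gx Gy e2; have [t yt tE] := creach_lt Gy Gz e2.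
  have := creach_le (reach_trans xs yt); lra.
Qed.

Let ltN1 (x : R) : 0 <= x -> -1 < x.
Proof. by apply: lt_le_trans; rewrite ltrN10. Qed.

Lemma lempert_tilde_ge0 x y : (0 <= lempert_tilde G x y)%E.
Proof. by apply: le_ereal_inf_tmp => _ [a [a1 _] <-]; rewrite lee_fin modulus_ge0. Qed.

Lemma lempert_le phi (a : Cx R) : holomorphic_disc G phi -> unit_disc a ->
  (lempert G (phi 0%R) (phi a) <= (artanh (modulus a))%:E)%E.
Proof.
move=> h a1; rewrite /lempert; have := lempert_tilde_ge0 (phi 0) (phi a).
have : (lempert_tilde G (phi 0%R) (phi a) <= (modulus a)%:E)%E.
  by apply: ereal_inf_lbound; exists a => //; split => //; exists phi.
case: lempert_tilde => [m| |] //=; rewrite !lee_fin => ma m0.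
by apply: artanh_le; [exact: ltN1 | exact: ma | apply/unit_discP].
Qed.

Lemma creach_le_lempert x y : G x -> G y -> ((creach G x y)%:E <= lempert G x y)%E.
Proof.
move=> Gx Gy; rewrite /lempert.
have Lth : ((th (creach G x y))%:E <= lempert_tilde G x y)%E.
  apply: le_ereal_inf_tmp => _ [a [a1 [phi [h px py]]] <-]; rewrite lee_fin.
  have am : modulus a < 1 by apply/unit_discP.
  rewrite -(@th_artanh _ (modulus a)) ?am ?ltN1 ?modulus_ge0// th_le.
  by rewrite -px -py; exact: creach_le (reach_holo h a1).
(* [artanh] is meaningful only in ]-1, 1[, so a finite value of [lempert_tilde] must be placed below
   1 before it is inverted. *)
have L1 : (lempert_tilde G x y = +oo \/ lempert_tilde G x y < 1%:E)%E.
  rewrite /lempert_tilde; set A := (X in ereal_inf X).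
  have [A0|/set0P[_ [a [a1 ha] _]]] := eqVneq A set0; first by left; rewrite A0 ereal_inf0.
  right; apply: (@le_lt_trans _ _ (modulus a)%:E); last by rewrite lte_fin; apply/unit_discP.
  by apply: ereal_inf_lbound; exists a.
have := lempert_tilde_ge0 x y.
move: Lth L1; case: lempert_tilde => [m| |] //=; rewrite ?leey//.
rewrite !lee_fin => cm [//|]; rewrite lte_fin => m1 m0.
by rewrite -th_le th_artanh// m1 ltN1.
Qed.

(** Induction on the chain: a disc recentred at its starting point competes in the Lempert function,
    and concatenation is the triangle inequality. *)
Lemma pseudodistance_le_reach d : pseudodistance_on G d ->
  (forall x y, G x -> G y -> ((d x y)%:E <= lempert G x y)%E) ->
  forall x y s, reach G x y s -> d x y <= s.
Proof.
move=> [d0 dxx dC dD] dl x y s [g [dg <- <-]].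
rewrite -[leRHS]subr0; elim: dg => [a b c phi ab h gE|a b c dab hab dbc hbc].
  have [psi [hpsi psiE psi0 _]] := holo_shift (a - c) h.
  have ga : g a = psi 0 by rewrite psi0 gE// lexx.
  have gb : g b = psi (rc (th (b - a))).
    by rewrite psiE gE ?ab ?lexx//; congr (phi (rc (th _))); ring.
  have th1 := @disc_th R (b - a).
  have := lempert_le hpsi th1; rewrite modulus_rc ger0_norm ?th_ge0 ?subr_ge0//.
  rewrite artanh_th -ga -gb -lee_fin; apply: le_trans; apply: dl.
    by rewrite ga; case: (hpsi _ disc0).
  by rewrite gb; case: (hpsi _ th1).
have ab := dpath_le dab; have bc := dpath_le dbc.
have Ga : G (g a) by apply: (dpath_in dab); rewrite lexx.
have Gb : G (g b) by apply: (dpath_in dab); rewrite lexx andbT.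
have Gc : G (g c) by apply: (dpath_in dbc); rewrite lexx andbT.
by apply: le_trans (dD _ _ _ Ga Gb Gc) _; lra.
Qed.

(** The infimum over chains is itself a pseudodistance below the Lempert function and dominates all
    the others, so it realizes the supremum. *)
Lemma kobE x y : G x -> G y -> kobayashi G x y = creach G x y.
Proof.
move=> Gx Gy; rewrite /kobayashi; set A := (X in sup X).
have ub : ubound A (creach G x y).
  move=> _ [d [pd dl] <-]; apply: lb_le_inf; first exact: reach_ex.
  by move=> s; exact: pseudodistance_le_reach.
have Ac : A (creach G x y).
  by exists (creach G) => //; split; [exact: pseudodistance_creach|exact: creach_le_lempert].
apply/eqP; rewrite eq_le; apply/andP; split.
  by apply: ge_sup => //; exists (creach G x y).
by apply: ub_le_sup => //; exists (creach G x y).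
Qed.

Lemma kob_le x y s : reach G x y s -> kobayashi G x y <= s.
Proof. by move=> h; have [Gx Gy] := reach_in h; rewrite kobE//; exact: creach_le. Qed.

Lemma kob_lt x y (e : R) : G x -> G y -> 0 < e ->
  exists2 s, reach G x y s & s < kobayashi G x y + e.
Proof. by move=> Gx Gy e0; rewrite kobE//; exact: creach_lt. Qed.

Lemma kob_ge0 x y : G x -> G y -> 0 <= kobayashi G x y.
Proof. by move=> Gx Gy; rewrite kobE//; case: pseudodistance_creach => h _ _ _; exact: h. Qed.

Lemma kobxx x : G x -> kobayashi G x x = 0.
Proof. by move=> Gx; rewrite kobE//; case: pseudodistance_creach => _ h _ _; exact: h. Qed.

Lemma kobC x y : G x -> G y -> kobayashi G x y = kobayashi G y x.
Proof. by move=> Gx Gy; rewrite !kobE//; case: pseudodistance_creach => _ _ h _; exact: h. Qed.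

Lemma kobD y x z : G x -> G y -> G z ->
  kobayashi G x z <= kobayashi G x y + kobayashi G y z.
Proof. by move=> Gx Gy Gz; rewrite !kobE//; case: pseudodistance_creach => _ _ _; exact. Qed.

(** An affine disc gives artanh (q / r) with q = |y - x|, which is at most 2 q / r while q <= r / 2.
    The continuity of [kobayashi] used later comes from this bound. *)
Lemma kob_local x y (r : R) : 0 < r -> rball x r `<=` G -> rnorm (y - x) <= r / 2 ->
  kobayashi G x y <= 2 / r * rnorm (y - x).
Proof.
move=> r0 xG yx; have q0 := rnorm_ge0 (y - x).
have yr : rnorm (y - x) < r by lra.
apply: le_trans (kob_le (reach_local r0 xG yr)) _.
have y2 : rnorm (y - x) / r <= 1 / 2 by rewrite ler_pdivrMr// mulrC mulrA mulr1.
have y0 : 0 <= rnorm (y - x) / r by rewrite divr_ge0// ltW.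
apply: le_trans (artanh_upper y0 _) _; first lra.
rewrite ler_pdivrMr; last lra.
have -> : 2 / r * rnorm (y - x) = 2 * (rnorm (y - x) / r) by ring.
nra.
Qed.

End Domain.

End Kobayashi.


(** * A Schwarz lemma *)

Section Schwarz.
Context {R : realType} {n : nat}.
Local Notation E := 'rV[Cx R]_n.
Implicit Types (G : set E) (phi : Cx R -> E) (x y : E).

(* The Schwarz lemma up to a constant.  It is deduced below from the existence of
   one hyperbolic domain, with no recourse to Cauchy's integral formula. *)
Definition schwarz_bound (A : R) := 0 < A /\
  forall phi (M : R), 0 < M -> holomorphic_disc (rball (phi 0) M) phi ->
  forall z, unit_disc z -> rnorm (phi z - phi 0) <= A * M * artanh (modulus z).

Let B : set E := rball 0 1.
Let oB : open B. Proof. exact: open_rball. Qed.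
Let cB : connected B. Proof. by apply: connected_rball; rewrite ltr01. Qed.
Let B0 : B 0. Proof. by apply: rball_center; rewrite ltr01. Qed.

(** A scaled copy of the unit ball lies in Omega, and scaling followed by inclusion does not
    increase Kobayashi distances. *)
Lemma kob_ball_gt0 (Omega : set E) : domain Omega -> hyperbolic Omega ->
  forall y, B y -> y != 0 -> 0 < kobayashi B 0 y.
Proof.
move=> [oO cO [z0 Oz0]] [_ hO] y By y0.
have [r r0 rO] := open_rballP oO Oz0.
pose f (u : E) : E := z0 + rc r *: u.
have fO u : B u -> Omega (f u).
  rewrite /B /rball /= subr0 => u1; apply: rO; rewrite /rball /f /= addrC addKr rnormZ.
  by rewrite modulus_rc gtr0_norm// -[ltRHS]mulr1 ltr_pM2l.
have f0 : f 0 = z0 by rewrite /f scaler0 addr0.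
have freach s : reach B 0 y s -> reach Omega z0 (f y) s.
  move=> [g [dg g0 gs]]; exists (f \o g); split => /=; last 2 first.
  - by rewrite g0 f0.
  - by rewrite gs.
  apply: dpath_map dg => phi h; apply: holo_affine (h) _ => z z1.
  by apply: fO; case: (h _ z1).
have le : kobayashi Omega z0 (f y) <= kobayashi B 0 y.
  apply/ler_addgt0Pr => e e0; have [s /freach rs /ltW] := kob_lt oB cB B0 By e0.
  by apply: le_trans; exact: kob_le.
apply: lt_le_trans le; rewrite lt_neqAle kob_ge0 ?andbT//; last exact: fO.
apply/negP => /eqP/esym /(hO _ _ Oz0 (fO _ By)) /esym/eqP.
rewrite /f -subr_eq0 addrC addKr scaler_eq0 (negbTE y0) orbF => /eqP.
by rewrite -rc0 => /rc_inj r00; rewrite r00 ltxx in r0.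
Qed.

(** The shell is compact and avoids 0. It is all that is needed, since a nonzero vector of norm
    below 1/4 has an integer multiple in it. *)
Lemma kob_ball_lower (Omega : set E) : domain Omega -> hyperbolic Omega ->
  exists2 c : R, 0 < c & forall x, 1 / 4 <= rnorm x <= 1 / 2 -> c <= kobayashi B 0 x.
Proof.
move=> dO hO; have pos := kob_ball_gt0 dO hO.
pose K : set E := [set y | rnorm (y - 0) <= 1 / 2] `&` ~` rball 0 (1 / 4).
have cK : compact K.
  apply: (subclosed_compact _ (@compact_le_rnorm _ _ (0 : E) (1 / 2))).
    by apply: closedI; [exact: closed_le_rnorm | exact: open_closedC (open_rball _ _)].
  by move=> ? [].
have KB y : K y -> B y.
  by move=> [+ _]; rewrite /B /rball /= => /le_lt_trans; apply; lra.
have Kpos y : K y -> 0 < kobayashi B 0 y.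
  move=> Ky; apply: pos; first exact: KB.
  by apply: contra_not_neq Ky.2 => ->; apply: rball_center; lra.
(* [compact_bound] yields upper bounds, hence the reciprocal. *)
have [|M hM] := @compact_bound _ _ K (fun y => (kobayashi B 0 y)^-1) cK.
  move=> y Ky; have k0 := Kpos _ Ky; set k := kobayashi B 0 y in k0 *.
  exists (k / 2)^-1.
  have [r r0 rB] := open_rballP oB (KB _ Ky).
  (* Within k r / 4 of y the distance to y is at most k / 2, which leaves at least k / 2 to the
     origin. *)
  apply/nbhs_rnormP; exists (Num.min (r / 2) (k * r / 4)).
    by rewrite lt_min !divr_gt0//= mulr_gt0.
  move=> y'; rewrite lt_min => /andP[y1 y2].
  have By' : B y' by apply: rB; rewrite /rball /=; lra.
  have lk : kobayashi B y y' <= 2 / r * rnorm (y' - y) by apply: kob_local => //; exact: ltW.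
  have l2 : 2 / r * rnorm (y' - y) <= k / 2.
    rewrite mulrAC ler_pdivrMr//; lra.
  have tri : k <= kobayashi B 0 y' + kobayashi B y' y by apply: kobD => //; exact: KB.
  rewrite (kobC oB cB By' (KB _ Ky)) in tri.
  have k2 : k / 2 <= kobayashi B 0 y' by lra.
  have k20 : 0 < k / 2 by rewrite divr_gt0.
  by rewrite lef_pV2 ?posrE//; exact: lt_le_trans k2.
have M0 : 0 < Num.max M 1 by rewrite lt_max ltr01 orbT.
exists (Num.max M 1)^-1; first by rewrite invr_gt0.
move=> x /andP[x1 x2].
have Kx : K x.
  by split; rewrite /rball /= subr0//; apply/negP; rewrite -leNgt.
have k0 := Kpos _ Kx; rewrite -[leRHS]invrK lef_pV2 ?posrE// ?invr_gt0//.
by rewrite le_max hM.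
Qed.

(* Translating [phi] by multiples of [x = phi z - phi 0] gives a chain of discs in
   the unit ball from [0] to [N x], where [N x] has norm between 1/4 and 1/2. *)
Lemma schwarz_half (c : R) : 0 < c ->
  (forall x, 1 / 4 <= rnorm x <= 1 / 2 -> c <= kobayashi B 0 x) ->
  forall phi z, holomorphic_disc (rball (phi 0) (1 / 2)) phi -> unit_disc z ->
  rnorm (phi z - phi 0) <= artanh (modulus z) / (2 * c).
Proof.
move=> c0 hc phi z hphi z1; set x := phi z - phi 0; set s := artanh _.
have xh : rnorm x < 1 / 2 by have [_] := hphi _ z1.
have s0 : 0 <= s by apply: artanh_ge0; [exact: modulus_ge0 | exact/unit_discP].
have [->|x0] := eqVneq x 0; first by rewrite rnorm0 divr_ge0//; lra.
have nx0 := rnorm_gt0 x0.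
have step j : j%:R * rnorm x <= 1 / 2 -> reach B (rc j%:R *: x) (rc j.+1%:R *: x) s.
  move=> jx; pose psi (w : Cx R) := (rc j%:R *: x - phi 0) + rc 1 *: phi w.
  have hpsi : holomorphic_disc B psi.
    apply: holo_affine (hphi) _ => w w1; rewrite /B /rball /= subr0 rc1 scale1r.
    rewrite -addrA; apply: le_lt_trans (rnormD _ _) _; rewrite rnormZ modulus_rc.
    have [_ pw] := hphi _ w1; rewrite /rball /= in pw; rewrite [_ + phi w]addrC ger0_norm ?ler0n//.
    by rewrite [ltRHS](splitr (1 : R)); exact: ler_ltD.
  have := reach_holo hpsi z1.
  rewrite /psi rc1 !scale1r subrK -addrA [- _ + _]addrC.
  by rewrite -natr1 rcD scalerDl rc1 scale1r.
have chain N : (forall j, (j < N)%N -> j%:R * rnorm x <= 1 / 2) ->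
    reach B 0 (rc N%:R *: x) (N%:R * s).
  elim: N => [_|N IH h]; first by rewrite rc0 scale0r mul0r; exact: reach_refl.
  rewrite -natr1 mulrDl mul1r; apply: (@reach_trans _ _ _ (rc N%:R *: x)).
    by apply: IH => j jN; apply: h; rewrite ltnS ltnW.
  by rewrite natr1; apply: step; exact: h.
have exN : exists N, 1 / 4 <= N%:R * rnorm x.
  exists (Num.truncn (1 / 4 / rnorm x)).+1; rewrite -ler_pdivrMr//.
  by apply/ltW/truncnS_gt.
(* Minimality of N keeps N |x| <= 1/2: each step adds at most 1/4, unless |x| > 1/4, and then N =
   1. *)
case: (ex_minnP exN) => N N1 Nmin.
have Nlt j : (j < N)%N -> j%:R * rnorm x < 1 / 4.
  by move=> jN; rewrite ltNge; apply/negP => /Nmin; rewrite leqNgt jN.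
have N0 : (0 < N)%N.
  by rewrite lt0n; apply/eqP => N00; move: N1; rewrite N00 mul0r; lra.
have Nx : N%:R * rnorm x <= 1 / 2.
  have [x4|x4] := leP (rnorm x) (1 / 4).
    have := Nlt N.-1; rewrite prednK// leqnn => /(_ isT) hN.
    by rewrite -[in N%:R](prednK N0) -natr1 mulrDl mul1r; lra.
  suff N_1 : N = 1%N by rewrite N_1 [leLHS]mul1r; apply: ltW.
  apply/eqP; rewrite eqn_leq N0 andbT; apply: Nmin.
  by rewrite [leRHS]mul1r ltW.
have NR : 0 < N%:R :> R by rewrite ltr0n.
have : c <= N%:R * s.
  apply: (@le_trans _ _ (kobayashi B 0 (rc N%:R *: x))).
    by apply: hc; rewrite rnormZ modulus_rc ger0_norm ?ler0n// N1.
  apply: kob_le => //; apply: chain => j /Nlt; lra.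
(* From c <= N s and N |x| <= 1/2 one gets 2 c |x| <= 2 s N |x| <= s. *)
move=> cs; rewrite ler_pdivlMr; last lra.
rewrite -(ler_pM2l NR); nra.
Qed.

Lemma schwarz_exists (Omega : set E) : domain Omega -> hyperbolic Omega ->
  exists A, schwarz_bound A.
Proof.
move=> dO hO; have [c c0 hc] := kob_ball_lower dO hO.
exists c^-1; split; first by rewrite invr_gt0.
move=> phi M M0 h z z1.
(* Division by 2 M brings the range into a ball of radius 1/2; undoing it turns the bound artanh |z|
   / (2 c) into M artanh |z| / c. *)
pose psi (w : Cx R) : E := 0 + rc (2 * M)^-1 *: phi w.
have M2 : 0 < 2 * M by lra.
have dist w : rnorm (psi w - psi 0) = (2 * M)^-1 * rnorm (phi w - phi 0).
  by rewrite /psi !add0r -scalerBr rnormZ modulus_rc gtr0_norm ?invr_gt0.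
have hpsi : holomorphic_disc (rball (psi 0) (1 / 2)) psi.
  apply: holo_affine (h) _ => w w1; rewrite /rball /= -/(psi w) dist.
  have [_] := h _ w1; rewrite /rball /= mulrC ltr_pdivrMr//; lra.
have := schwarz_half c0 hc hpsi z1; rewrite dist mulrC ler_pdivrMr// => /le_trans; apply.
rewrite le_eqVlt; apply/orP; left; apply/eqP; field; rewrite gt_eqF//.
Qed.

End Schwarz.


(** * Lower integrals *)

(* The integral of a nonnegative function is by definition the supremum of the
   integrals of the simple functions below it, so that comparing integrals does
   not require the measurability of the Kobayashi-Royden metric along a curve. *)
Section LowerIntegral.
Context d (T : measurableType d) {R : realType} (mu : {measure set T -> \bar R}).
Implicit Types (D : set T) (f : T -> \bar R).
Lemma lower_integral_le D f g : (forall x, D x -> (0 <= f x)%E) ->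
  (forall x, D x -> (f x <= g x)%E) ->
  (\int[mu]_(x in D) f x <= \int[mu]_(x in D) g x)%E.
Proof.
move=> f0 fg; have g0 x : D x -> (0 <= g x)%E by move=> Dx; exact: le_trans (f0 _ Dx) (fg _ Dx).
rewrite !ge0_integralE//; apply: le_ereal_sup => _ [h hf <-]; exists h => // x.
apply: le_trans (hf x) _; rewrite !patchE; case: ifPn => // /set_mem; exact: fg.
Qed.

Lemma lower_integral_sup D f (M : \bar R) : measurable D -> (forall x, D x -> (0 <= f x)%E) ->
  (forall h : {nnsfun T >-> R}, (forall x, D x -> ((h x)%:E <= f x)%E) ->
     (\int[mu]_(x in D) (h x)%:E <= M)%E) ->
  (\int[mu]_(x in D) f x <= M)%E.
Proof.
move=> mD f0 hM; rewrite ge0_integralE//; apply: ge_ereal_sup => _ [h hf <-].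
have hD x : ~ D x -> h x = 0.
  move=> Dx; apply/eqP; rewrite eq_le fun_ge0 andbT -lee_fin.
  by apply: le_trans (hf x) _; rewrite patchE memNset.
have -> : sintegral mu h = (\int[mu]_(x in D) (h x)%:E)%E.
  rewrite integral_nnsfun//; congr (sintegral mu _); apply/funext => x.
  by rewrite patchE; case: ifPn => // /negP; rewrite inE => /hD.
apply: hM => x Dx; apply: le_trans (hf x) _.
by rewrite patchE mem_set.
Qed.

End LowerIntegral.

(** * Nearly minimal chains are geodesics *)

Section Lipschitz.
Context {R : realType} {n : nat}.
Local Notation E := 'rV[Cx R]_n.
Implicit Types (G : set E) (phi : Cx R -> E) (g : R -> E) (x y : E).

Lemma holo_continuous G phi z : holomorphic_disc G phi -> unit_disc z ->
  forall e : R, 0 < e -> exists2 d : R, 0 < d & forall w, modulus (w - z) < d ->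
    unit_disc w /\ rnorm (phi w - phi z) < e.
Proof.
move=> h z1 e e0; have [dphi _] := h _ z1.
have [d d0 hd] := derive_eps dphi (@ltr01 R).
have L0 := rnorm_ge0 (derive1 phi z); set L := rnorm _ in L0.
have m1 : modulus z < 1 by apply/unit_discP.
exists (Num.min d (Num.min (1 - modulus z) (e / (L + 1)))).
  by rewrite !lt_min d0 subr_gt0 m1 divr_gt0// ltr_wpDl.
move=> w; rewrite !lt_min => /and3P[wd w1 we]; split.
  by apply/unit_discP; have := modulusD (w - z) z; rewrite subrK; lra.
have := hd (w - z) wd; rewrite [z + _]addrC subrK mul1r => hw.
have := rnormD (phi w - phi z - (w - z) *: derive1 phi z) ((w - z) *: derive1 phi z).
rewrite subrK rnormZ -/L; have := we; rewrite ltr_pdivlMr; last by rewrite ltr_wpDl.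
move: hw; lra.
Qed.

(** Discs are only complex differentiable at each point. The Lipschitz bound comes from the Schwarz
    bound for the small discs w -> phi (v + r w), one for each v near z. *)
Lemma holo_loclip A G phi z : schwarz_bound (R := R) (n := n) A -> holomorphic_disc G phi ->
  unit_disc z -> exists d L : R, [/\ 0 < d, 0 <= L & forall u v,
    modulus (u - z) < d -> modulus (v - z) < d -> rnorm (phi u - phi v) <= L * modulus (u - v)].
Proof.
move=> [A0 hA] h z1; have [d d0 hd] := holo_continuous h z1 (@ltr01 R).
(* With r = d / 2, the point u has parameter of modulus |u - v| / r <= 1/2, where artanh at most
   doubles: this gives 4 / d. Values of a small disc differ by less than 2, so its range fits in a
   ball of radius 3. *)
exists (d / 8), (A * 3 * (4 / d)); split; first by rewrite divr_gt0.
  by rewrite ltW// !mulr_gt0// invr_gt0.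
move=> u v ud vd; pose r := d / 2.
have r0 : 0 < r by rewrite divr_gt0.
pose psi (w : Cx R) := phi (v + rc r * w).
have close w : unit_disc w -> modulus (v + rc r * w - z) < d.
  move=> /unit_discP w1; rewrite addrAC; apply: le_lt_trans (modulusD _ _) _.
  rewrite modulusM modulus_rc gtr0_norm//.
  have : r * modulus w < r by rewrite -[ltRHS]mulr1 ltr_pM2l.
  by have : r = d / 2 by []; lra.
have hpsi : holomorphic_disc (rball (psi 0) 3) psi.
  move=> w w1; have [v1 _] := hd _ (close _ w1); split; last first.
    have [_ b1] := hd _ (close _ w1); have [_ b2] := hd _ (close _ disc0).
    by rewrite /rball /=; have := rdistD (phi z) (psi w) (psi 0); rewrite (rdistC (phi z)) /psi; lra.
  have [dphi _] := h _ v1.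
  have dm : derivable (fun w : Cx R => v + rc r * w) w 1.
    have [dm _] : is_derive w (1 : Cx R) (fun w : Cx R => v + rc r * w) (0 + rc r).
      by apply: is_deriveD; exact: is_derive_mulc.
    exact: dm.
  exact: (derivable_comp dm dphi).
pose w := (rc r)^-1 * (u - v).
have rn0 : rc r != 0 by apply/eqP => /rc_inj; apply/eqP; rewrite gt_eqF.
have mw : modulus w = modulus (u - v) / r.
  by rewrite modulusM modulusV modulus_rc gtr0_norm// mulrC.
have uv : modulus (u - v) < d / 4.
  have := modulusD (u - z) (z - v); rewrite addrA subrK.
  have -> : modulus (z - v) = modulus (v - z) by rewrite !modulusE rdistC.
  lra.
have w2 : modulus w <= 1 / 2 by rewrite mw ler_pdivrMr// /r; lra.
have w1 : unit_disc w by apply/unit_discP; lra.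
have := hA psi 3 (ltac:(lra)) hpsi w w1.
rewrite /psi mulr0 addr0 /w mulrA divff// mul1r [v + _]addrC subrK -/w.
have aw : artanh (modulus w) <= 2 * modulus w.
  apply: le_trans (artanh_upper (modulus_ge0 w) _) _; first lra.
  rewrite ler_pdivrMr; last lra.
  have := modulus_ge0 w; nra.
have A3 : 0 <= A * 3 by rewrite mulr_ge0// ltW.
move=> /le_trans; apply; apply: le_trans (ler_wpM2l A3 aw) _.
rewrite mw /r le_eqVlt; apply/orP; left; apply/eqP; field; rewrite gt_eqF//.
Qed.

Definition lip_curve g (a b : R) := exists2 L : R, 0 <= L &
  forall s t, a <= s <= b -> a <= t <= b -> rnorm (g s - g t) <= L * `|s - t|.

Lemma loclip_lipschitz g (a b : R) :
  (forall t, a <= t <= b -> exists d L : R, [/\ 0 < d, 0 <= L & forall u v,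
     a <= u <= b -> a <= v <= b ->
     `|u - t| < d -> `|v - t| < d -> rnorm (g u - g v) <= L * `|u - v|]) ->
  lip_curve g a b.
Proof.
move=> loc.
have /compact_near_coveringP/(_ R (+oo) (fun i t => a <= t <= b ->
  (forall s, a <= s <= b -> `|s - t| * i < 1 -> rnorm (g s - g t) <= i * `|s - t|)
     /\ rnorm (g t) <= i)) := @segment_compact R a b.
move=> nc; have [|i [_ ni]] := nc _.
  move=> t0; rewrite /= in_itv /= => t0ab; have [d [L [d0 L0 hL]]] := loc _ t0ab.
  have M0 := rnorm_ge0 (g t0).
  exists (ball t0 (d / 2), [set i | L + 2 / d + (rnorm (g t0) + L * d) < i]).
    by split; [apply: nbhsx_ballx; rewrite divr_gt0|exact: nbhs_pinfty_gt (num_real _)].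
  move=> [t i] /= []; rewrite /ball /= distrC => tt0 hi tab.
  have d20 : 0 < 2 / d by rewrite divr_gt0.
  have Ld : 0 <= L * d by rewrite mulr_ge0// ltW.
  have tt0' : `|t - t0| < d by lra.
  split=> [s sab si|]; last first.
    have : rnorm (g t - g t0) <= L * d.
      apply: le_trans (hL t t0 tab t0ab tt0' _) _; first by rewrite subrr normr0.
      by rewrite ler_wpM2l// ltW.
    have := rnormD (g t - g t0) (g t0); rewrite subrK; lra.
  have i2 : 2 / d < i by lra.
  have st : `|s - t| < d / 2.
    have : `|s - t| * (2 / d) < 1.
      by apply: le_lt_trans si; rewrite ler_wpM2l// ltW.
    rewrite mulrA ltr_pdivrMr// mul1r; lra.
  have st0 : `|s - t0| < d by have := ler_normD (s - t) (t - t0); rewrite addrA subrK; lra.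
  apply: le_trans (hL s t sab tab st0 tt0') _; rewrite ler_wpM2r//; lra.
have := ni (Num.max i 0 + 1) (ltac:(by rewrite ltr_pwDr// le_max lexx)).
set k := _ + 1 => hk.
have k0 : 0 < k by rewrite ltr_wpDl// le_max lexx orbT.
(* Times with |s - t| k < 1 obey the constant k. For the others |g s - g t| <= 2 k, which is at most
   2 k k |s - t|. *)
exists (k + 2 * k * k); first by rewrite ltW// addr_gt0// !mulr_gt0.
move=> s t sab tab; have [h1 h2] := hk t (ltac:(by rewrite /= in_itv)) tab.
have [_ h3] := hk s (ltac:(by rewrite /= in_itv)) sab.
have a0 := normr_ge0 (s - t).
have [st|st] := ltP (`|s - t| * k) 1.
  apply: le_trans (h1 s sab st) _; rewrite ler_wpM2r// lerDl ltW// !mulr_gt0//.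
have := rnormB (g s) (g t) => h4.
have : 2 * k <= 2 * k * (`|s - t| * k) by rewrite ler_peMr// ltW// mulr_gt0.
have : 0 <= k * `|s - t| by rewrite mulr_ge0// ltW.
rewrite mulrDl; lra.
Qed.

End Lipschitz.


Section Geodesics.
Context {R : realType} {n : nat}.
Local Notation E := 'rV[Cx R]_n.
Implicit Types (G D : set E) (phi : Cx R -> E) (g : R -> E) (x y : E).

Lemma lip_curve_cat g (a b c : R) : a <= b -> b <= c ->
  lip_curve g a b -> lip_curve g b c -> lip_curve g a c.
Proof.
move=> ab bc [L L0 hL] [M M0 hM]; exists (L + M); first exact: addr_ge0.
have key s t : s <= t -> a <= s <= c -> a <= t <= c ->
    rnorm (g s - g t) <= (L + M) * `|s - t|.
  move=> st /andP[as_ sc] /andP[at_ tc].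
  have p0 := normr_ge0 (s - t).
  have [tb|/ltW bt] := leP t b.
    apply: le_trans (hL s t _ _) _; rewrite ?as_ ?at_ ?(le_trans st)//.
    by rewrite ler_wpM2r// lerDl.
  have [sb|/ltW bs] := leP s b; last first.
    apply: le_trans (hM s t _ _) _; rewrite ?bs ?bt//.
    by rewrite ler_wpM2r// lerDr.
  apply: le_trans (rdistD (g b) _ _) _; rewrite mulrDl; apply: lerD.
    apply: le_trans (hL s b _ _) _; rewrite ?as_ ?sb ?ab ?lexx//.
    by rewrite ler_wpM2l// !ler0_norm ?subr_le0//; lra.
  apply: le_trans (hM b t _ _) _; rewrite ?bt ?lexx ?bc//.
  by rewrite ler_wpM2l// !ler0_norm ?subr_le0//; lra.
move=> s t sac tac; have [st|/ltW ts] := leP s t; first exact: key.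
by rewrite rdistC distrC; exact: key.
Qed.

Lemma dpath_lipschitz A G g (a b : R) : schwarz_bound (R := R) (n := n) A ->
  dpath G g a b -> lip_curve g a b.
Proof.
move=> hA; elim=> [{}a {}b c phi ab h gE|{}a {}b c dab hab dbc hbc]; last first.
  exact: lip_curve_cat (dpath_le dab) (dpath_le dbc) hab hbc.
apply: loclip_lipschitz => t tab.
have [d [L [d0 L0 hL]]] := holo_loclip hA h (@disc_th R (t - c)).
exists d, L; split => // u v uab vab ut vt.
have mth (s s' : R) : modulus (rc (th (s - c)) - rc (th (s' - c))) <= `|s - s'|.
  rewrite -rcB modulus_rc; apply: le_trans (th_dist _ _) _.
  by rewrite opprB addrA subrK.
rewrite !gE//; apply: le_trans (hL _ _ _ _) _; last by rewrite ler_wpM2l.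
- exact: le_lt_trans (mth _ _) ut.
- exact: le_lt_trans (mth _ _) vt.
Qed.

Lemma lipschitz_ac (f : R -> R) (a b L : R) : 0 <= L ->
  (forall s t, a <= s <= b -> a <= t <= b -> `|f s - f t| <= L * `|s - t|) ->
  absolutely_continuous a b f.
Proof.
move=> L0 hL e e0; have L1 : 0 < L + 1 by rewrite ltr_wpDl.
exists (e / (L + 1)); first by rewrite divr_gt0.
move=> s hs _ hd; apply: (@le_lt_trans _ _ (L * \sum_(J <- s) (J.2 - J.1))).
  rewrite mulr_sumr !big_seq; apply: ler_sum => J /(allP hs)/and3P[aJ J12 Jb].
  apply: le_trans (hL _ _ _ _) _.
  - by rewrite Jb (le_trans aJ).
  - by rewrite aJ (le_trans J12).
  - by rewrite ger0_norm// subr_ge0.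
have S0 : 0 <= \sum_(J <- s) (J.2 - J.1).
  by rewrite big_seq; apply: sumr_ge0 => J /(allP hs)/and3P[_ J12 _]; rewrite subr_ge0.
by move: hd; rewrite ltr_pdivlMr// mulrDr mulr1 mulrC; lra.
Qed.

Lemma lipschitz_acc g (a b : R) : lip_curve g a b -> absolutely_continuous_curve a b g.
Proof.
move=> [L L0 hL] j.
have co s t : modulus (g s 0 j - g t 0 j) <= rnorm (g s - g t).
  by have := norm_coord (g s - g t) j; rewrite !mxE.
split; apply: (@lipschitz_ac _ _ _ L) => // s t sab tab; apply: le_trans (hL _ _ sab tab);
  apply: le_trans (co s t).
- have -> : complex.Re (g s 0 j) - complex.Re (g t 0 j) = complex.Re (g s 0 j - g t 0 j).
    by case: (g s 0 j) => ? ?; case: (g t 0 j).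
  exact: Re_le_modulus.
- have -> : complex.Im (g s 0 j) - complex.Im (g t 0 j) = complex.Im (g s 0 j - g t 0 j).
    by case: (g s 0 j) => ? ?; case: (g t 0 j).
  exact: Im_le_modulus.
Qed.

Lemma real_derive_eps (f : R -> R) (t l : R) :
  (forall e, 0 < e -> exists2 d, 0 < d & forall h, `|h| < d ->
     `|f (t + h) - f t - h * l| <= e * `|h|) -> is_derive t 1 f l.
Proof.
move=> hf.
have cv : (fun h => h^-1 *: ((f \o shift t) (h *: 1) - f t)) @ (0 : R)^' --> l.
  apply/cvgrPdist_le => e e0; have [d d0 hd] := hf e e0.
  apply/nbhs_ballP; exists d => // h; rewrite /ball /= sub0r normrN => /hd hh h0.
  have n0 : 0 < `|h| by rewrite normr_gt0.
  rewrite -(ler_pM2l n0) -normrM mulrBr [h *: 1]mulr1 -[_^-1 *: _]/(_^-1 * _) mulrA divff// mul1r.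
  by rewrite distrC [h + t]addrC [leRHS]mulrC.
by apply: DeriveDef; [apply/cvg_ex; exists l; exact: cv | exact: (cvg_lim _ cv)].
Qed.

(** Recentred at time t, the disc is run through as psi (th (s - t)); as th has derivative 1 at 0,
    the velocity of the curve is the derivative of psi at 0. *)
Lemma curve_derivative_disc phi (a b c t : R) g G : holomorphic_disc G phi ->
  a < t < b -> (forall s, a <= s <= b -> g s = phi (rc (th (s - c)))) ->
  exists psi, [/\ holomorphic_disc G psi, psi 0 = g t & derive1 psi 0 = curve_derivative g t].
Proof.
move=> h /andP[at_ tb] gE; have [psi [hpsi psiE psi0 _]] := holo_shift (t - c) h.
exists psi; split => //; first by rewrite psi0 gE// !ltW.
set L := derive1 psi 0.
have [dpsi _] := hpsi _ disc0.
have gpsi : \forall s \near t, psi (rc (th (s - t))) = g s.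
  have : \forall s \near t, s \in `]a, b[%R by apply: near_in_itvoo; rewrite in_itv /= at_.
  apply: filterS => s; rewrite in_itv /= => /andP[as_ sb].
  by rewrite psiE gE ?ltW//; congr (phi (rc (th _))); ring.
have dths : is_derive t 1 (fun s : R => th (s - t)) 1.
  have d1 : is_derive t 1 (fun s : R => s - t) 1.
    by rewrite -[X in is_derive _ _ _ X]subr0; apply: is_deriveB.
  have d2 : is_derive (t - t) 1 th 1.
    by have := is_derive_th (t - t); rewrite [X in th X ^+ 2]subrr th0 expr0n subr0.
  have := @is_derive1_comp _ th (fun s : R => s - t) t _ _ d2 d1; rewrite mulr1; exact.
(* P stands for the real and for the imaginary part at once. *)
have key (P : Cx R -> R) j : (forall u v, P (u - v) = P u - P v) ->
    (forall h u, P (rc h * u) = h * P u) -> (forall u, `|P u| <= modulus u) ->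
    derive1 (fun s => P (g s 0 j)) t = P (L 0 j).
  move=> PB PM Pm.
  have dF : is_derive (t - t) 1 (fun u : R => P (psi (rc u) 0 j)) (P (L 0 j)).
    rewrite subrr; apply: real_derive_eps => e e0.
    have [d d0 hd] := derive_eps dpsi e0; exists d => // k kd.
    have := hd (rc k); rewrite modulus_rc !add0r => /(_ kd).
    apply: le_trans; rewrite -PB -PM -PB; apply: le_trans (Pm _) _.
    by have := norm_coord (psi (rc k) - psi 0 - rc k *: L) j; rewrite !mxE.
  have dF' : is_derive (th (t - t)) 1 (fun u : R => P (psi (rc u) 0 j)) (P (L 0 j)).
    by rewrite subrr th0; rewrite subrr in dF.
  have dc := @is_derive1_comp _ (fun u : R => P (psi (rc u) 0 j))
    (fun s : R => th (s - t)) t _ _ dF' dths.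
  rewrite mulr1 in dc.
  have [_] : is_derive t 1 (fun s : R => P (g s 0 j)) (P (L 0 j)).
    by apply: near_eq_is_derive dc; apply: filterS gpsi => s /= ->.
  by rewrite derive1E.
apply/rowP => j; rewrite mxE (key (@complex.Re R)) ?(key (@complex.Im R)).
- by case: (L 0 j).
- by move=> [? ?] [? ?].
- by move=> k [? ?] /=; rewrite mul0r addr0.
- exact: Im_le_modulus.
- by move=> [? ?] [? ?].
- by move=> k [? ?] /=; rewrite mul0r subr0.
- exact: Re_le_modulus.
Qed.

Lemma kobayashi_royden_ge0 G x v : (0 <= kobayashi_royden G x v)%E.
Proof. by apply: le_ereal_inf_tmp => _ [a _ <-]; rewrite lee_fin modulus_ge0. Qed.

Lemma kobayashi_royden_le G phi (a : Cx R) : holomorphic_disc G phi ->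
  (kobayashi_royden G (phi 0%R) (a *: derive1 phi 0%R) <= (modulus a)%:E)%E.
Proof.
by move=> h; apply: ereal_inf_lbound; exists a => //; exists phi.
Qed.

(** Inside a piece the recentred disc competes with factor 1. F collects the end points of the
    pieces, where the two-sided derivative is not controlled. *)
Lemma dpath_royden G g (a b : R) : dpath G g a b -> exists F : seq R,
  forall t, a <= t <= b -> t \notin F ->
  (kobayashi_royden G (g t) (curve_derivative g t) <= 1)%E.
Proof.
elim=> [{}a {}b c phi ab h gE|{}a {}b c dab [F hF] dbc [F' hF']].
  exists [:: a; b] => t /andP[at_ tb]; rewrite !inE negb_or => /andP[ta tb'].
  have tab : a < t < b by rewrite !lt_neqAle at_ tb eq_sym ta tb'.
  have [psi [hpsi psi0 <-]] := curve_derivative_disc h tab gE.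
  rewrite -psi0 -[X in kobayashi_royden _ _ X]scale1r.
  apply: le_trans (kobayashi_royden_le _ hpsi) _.
  by rewrite -rc1 modulus_rc normr1.
exists (F ++ F') => t /andP[at_ tc]; rewrite mem_cat negb_or => /andP[tF tF'].
have [tb|/ltW bt] := leP t b; first by apply: hF => //; rewrite at_.
by apply: hF' => //; rewrite bt.
Qed.

Lemma holo_component D phi z : holomorphic_disc D phi -> unit_disc z ->
  holomorphic_disc (connected_component D (phi z)) phi.
Proof.
move=> h z1 w w1; have [dw _] := h _ w1; split; first exact: dw.
apply: (@connected_component_max _ _ (phi @` (@unit_disc R))).
- by exists z.
- by move=> _ [u u1 <-]; case: (h _ u1).
- apply: connected_continuous_connected; first exact: connected_disc.
  apply: continuous_in_subspaceT => u /set_mem u1; have [du _] := h _ u1.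
  exact: differentiable_continuous (iffLR (derivable1_diffP _ _) du).
- by exists w.
Qed.

Lemma dpath_component D g (a b : R) : dpath D g a b ->
  forall t, a <= t <= b -> dpath (connected_component D (g t)) g a b.
Proof.
elim=> [{}a {}b c phi ab h gE t tab|{}a {}b c dab hab dbc hbc t].
  apply: (@dpath_disc _ _ _ _ _ _ c phi) => //; rewrite gE//.
  exact: holo_component h (disc_th _).
have ab := dpath_le dab; have bc := dpath_le dbc.
have bab : a <= b <= b by rewrite ab lexx.
have bbc : b <= b <= c by rewrite bc lexx.
move=> /andP[at_ tc].
have -> : connected_component D (g t) = connected_component D (g b).
  apply: esym; apply: same_connected_component.
  have [tb|/ltW bt] := leP t b.
    by apply: (dpath_in (hab _ bab)); rewrite at_.
  by apply: (dpath_in (hbc _ bbc)); rewrite bt.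
exact: dpath_cat (hab _ bab) (hbc _ bbc).
Qed.

Lemma component_dpath D g (a b : R) : dpath D g a b ->
  forall s t, a <= s <= b -> a <= t <= b ->
  connected_component D (g s) = connected_component D (g t).
Proof.
move=> dg s t sab tab; apply: same_connected_component.
exact: (dpath_in (dpath_component dg sab)).
Qed.

Lemma royden_length_dpath D g (a b : R) : dpath D g a b ->
  forall s t, a <= s -> s <= t -> t <= b -> (royden_length D g s t <= (t - s)%:E)%E.
Proof.
move=> dg s t as_ st tb; have dgst := dpath_sub dg as_ st tb.
have sst : s <= s <= t by rewrite lexx.
have [F hF] := dpath_royden (dpath_component dgst sst).
have mI : measurable `[s, t]%classic by [].
rewrite /royden_length; apply: lower_integral_sup => //.
  by move=> u _; exact: kobayashi_royden_ge0.
have mst : lebesgue_measure `[s, t]%classic = (t - s)%:E.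
  rewrite lebesgue_measure_itv /= lte_fin.
  by case: ltgtP st => // -> _; rewrite subrr.
move=> h hh; rewrite -mst -[leRHS]mul1e -integral_cst//.
apply: ae_ge0_le_integral => //.
- by move=> x _; rewrite lee_fin; exact: fun_ge0.
- by apply/measurable_EFinP; exact: measurable_funTS.
- exists [set` F]; split.
  + apply: countable_measurable; first exact: measurable_set1.
    exact: finite_set_countable (finite_seq F).
  + exact: countable_lebesgue_measure0 (finite_set_countable (finite_seq F)).
  + move=> x /= /not_implyP[xI hx]; apply: contrapT => /negP xF; apply: hx.
    apply: le_trans (hh x xI) _; move: xI; rewrite /= in_itv /= => xst.
    have := hF x xst xF; rewrite (component_dpath dgst sst xst); exact.
Qed.

(** Time bounds distance on [a, s] and on [t, b], so by the triangle inequality the excess e of time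
    over distance on [a, b] also serves on [s, t]; and time bounds the Royden length. *)
Lemma dpath_geodesic A D g (a b e : R) : schwarz_bound (R := R) (n := n) A -> open D ->
  dpath D g a b ->
  b - a <= kobayashi (connected_component D (g a)) (g a) (g b) + e ->
  geodesic 1 e D a b g.
Proof.
move=> hA oD dg ab_e; have ab := dpath_le dg; split => //.
- exact: dpath_in dg.
- exact: lipschitz_acc (dpath_lipschitz hA dg).
move=> s t as_ st tb; apply: le_trans (royden_length_dpath dg as_ st tb) _.
have aab : a <= a <= b by rewrite lexx.
have sab : a <= s <= b by rewrite as_ (le_trans st).
have tab : a <= t <= b by rewrite tb (le_trans as_).
have bab : a <= b <= b by rewrite ab lexx.
rewrite lee_fin mul1r -(component_dpath dg aab sab).
have dG := dpath_component dg aab.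
set G := connected_component D (g a) in ab_e dG *.
have oG : open G by exact: open_component.
have cG : connected G by exact: component_connected.
have Gin := dpath_in dG.
have k1 := kob_le oG cG (dpath_reach (dpath_sub dG (lexx _) as_ (le_trans st tb))).
have k2 := kob_le oG cG (dpath_reach (dpath_sub dG (le_trans as_ st) tb (lexx _))).
have k3 := kobD oG cG (Gin _ aab) (Gin _ sab) (Gin _ bab).
have k4 := kobD oG cG (Gin _ sab) (Gin _ tab) (Gin _ bab).
lra.
Qed.

End Geodesics.


(** * Localization *)

Section Decay.
Context {R : realType}.
Implicit Types (d : R -> R -> R).

(** Unit steps away from t0: the step starting at s costs at most C exp (-(s - t0)), and as exp (-1)
    <= 1/2 the remaining tail costs no more than that, so the factor 2 reproduces itself. *)
Let decay_right d (a b t0 C : R) : 0 <= C ->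
  (forall s t u, a <= s -> s <= t -> t <= u -> u <= b -> d s u <= d s t + d t u) ->
  (forall s t m : R, a <= s -> s <= t -> t <= b -> 0 <= m ->
     (forall u, s <= u <= t -> m <= `|u - t0|) -> d s t <= (1 + C * expR (- m)) * (t - s)) ->
  forall (N : nat) s, a <= s -> t0 <= s -> s <= b -> b - s <= N%:R ->
  d s b <= (b - s) + 2 * C * expR (- (s - t0)).
Proof.
move=> C0 dD dm.
have far s t u : t0 <= s -> s <= u <= t -> s - t0 <= `|u - t0|.
  by move=> t0s /andP[su _]; rewrite ger0_norm; lra.
have CE0 s : 0 <= C * expR (- (s - t0)) by rewrite mulr_ge0// expR_ge0.
have short s : a <= s -> t0 <= s -> s <= b -> b - s <= 1 ->
    d s b <= (b - s) + 2 * C * expR (- (s - t0)).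
  move=> as_ t0s sb bs1; have s0 : 0 <= s - t0 by rewrite subr_ge0.
  apply: le_trans (dm s b (s - t0) as_ sb (lexx _) s0 (fun u => @far s b u t0s)) _.
  by move: (CE0 s); rewrite -mulrA; set X := C * _ => X0; nra.
elim=> [|N IH] s as_ t0s sb bs; first by apply: short => //; lra.
have [bs1|bs1] := leP (b - s) 1; first exact: short.
have s0 : 0 <= s - t0 by rewrite subr_ge0.
have h1 := dm s (s + 1) (s - t0) as_ (ltac:(lra)) (ltac:(lra)) s0 (fun u => @far s (s + 1) u t0s).
have bsN : b - (s + 1) <= N%:R.
  by have N1 : N.+1%:R = N%:R + 1 :> R; [rewrite natr1 | lra].
have h2 := IH (s + 1) (ltac:(lra)) (ltac:(lra)) (ltac:(lra)) bsN.
have h3 := dD s (s + 1) b as_ (ltac:(lra)) (ltac:(lra)) (lexx _).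
have e1 : expR (- (s + 1 - t0)) <= expR (- (s - t0)) / 2.
  have -> : - (s + 1 - t0) = - (s - t0) + (- 1) by ring.
  rewrite expRD ler_wpM2l ?expR_ge0// expRN lef_pV2 ?posrE ?expR_gt0//.
  by have := expR_ge1Dx (1 : R); lra.
have h4 : 2 * C * expR (- (s + 1 - t0)) <= C * expR (- (s - t0)).
  by have := ler_wpM2l C0 e1; lra.
move: h1 h2 h3 h4 (CE0 s); rewrite -![2 * C * _]mulrA.
set X := C * expR (- (s - t0)); set Y := C * _ => g1 g2 g3 g4 g5; lra.
Qed.

Lemma sum_decay d (a b t0 C : R) : a <= t0 <= b -> 0 <= C ->
  (forall s t u, a <= s -> s <= t -> t <= u -> u <= b -> d s u <= d s t + d t u) ->
  (forall s t m : R, a <= s -> s <= t -> t <= b -> 0 <= m ->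
     (forall u, s <= u <= t -> m <= `|u - t0|) -> d s t <= (1 + C * expR (- m)) * (t - s)) ->
  d a b <= (b - a) + 4 * C.
Proof.
move=> /andP[at0 t0b] C0 dD dm.
have r1 : d t0 b <= (b - t0) + 2 * C.
  have := decay_right C0 dD dm (N := (Num.truncn (b - t0)).+1) at0 (lexx _) t0b (ltW (truncnS_gt _)).
  by rewrite subrr oppr0 expR0 mulr1.
have r2 : d a t0 <= (t0 - a) + 2 * C.
  (* The part before t0 is treated by reversing time; each side contributes 2 C. *)
  have := @decay_right (fun s t => d (- t) (- s)) (- b) (- a) (- t0) C C0 _ _
    (Num.truncn (- a - - t0)).+1 (- t0) _ (lexx _) _ (ltW (truncnS_gt _)).
  rewrite subrr oppr0 expR0 mulr1 !opprK [- a + t0]addrC; apply.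
  - by move=> s t u bs st tu ua; rewrite addrC; apply: dD; lra.
  - move=> s t m bs st ta m0 hm; have -> : t - s = - s - - t by ring.
    apply: dm => //; try lra.
    move=> u /andP[u1 u2]; rewrite distrC addrC; apply: hm; apply/andP; split; lra.
  - lra.
  - lra.
have := dD a t0 b (lexx _) at0 t0b (lexx _); lra.
Qed.

End Decay.


Section Localize.
Context {R : realType} {n : nat}.
Local Notation E := 'rV[Cx R]_n.
Implicit Types (G D : set E) (phi : Cx R -> E) (g : R -> E) (x y z : E).

Definition kob_comp D x y : R := kobayashi (connected_component D x) x y.

Lemma kob_compE D x y : connected D -> D x -> kob_comp D x y = kobayashi D x y.
Proof. by move=> cD Dx; rewrite /kob_comp connected_component_id. Qed.

Section KobComp.
Variable D : set E.
Hypothesis oD : open D.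
Let oC x : open (connected_component D x). Proof. exact: open_component. Qed.
Let cC x : connected (connected_component D x). Proof. exact: component_connected. Qed.

Lemma component_refl x y : connected_component D x y -> connected_component D x x.
Proof.
by move=> xy; exact: connected_component_trans xy (connected_component_sym xy).
Qed.

Lemma reach_component x y s : reach D x y s -> reach (connected_component D x) x y s.
Proof.
move=> [g [dg g0 gs]]; exists g; split => //; rewrite -g0.
by apply: (dpath_component dg); rewrite lexx (dpath_le dg).
Qed.

Lemma reach_connected x y s : reach D x y s -> connected_component D x y.
Proof. by move=> /reach_component xy; case: (reach_in xy). Qed.

Lemma kob_comp_le x y s : reach D x y s -> kob_comp D x y <= s.
Proof. by move=> /reach_component; exact: kob_le. Qed.

Lemma kob_comp_lt x y (e : R) : connected_component D x y -> 0 < e ->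
  exists2 s, reach D x y s & s < kob_comp D x y + e.
Proof.
move=> xy e0; have [s rs sE] := kob_lt (oC (x := x)) (cC (x := x)) (component_refl xy) xy e0.
by exists s => //; exact: reach_mono (@connected_component_sub _ _ _) rs.
Qed.

Lemma kob_comp_ge0 x y : connected_component D x y -> 0 <= kob_comp D x y.
Proof. by move=> xy; apply: kob_ge0 => //; exact: component_refl xy. Qed.

Lemma kob_comp_sym x y : connected_component D x y -> kob_comp D x y = kob_comp D y x.
Proof.
move=> xy; rewrite /kob_comp -(same_connected_component xy); apply: kobC => //.
exact: component_refl xy.
Qed.

Lemma kob_comp_tri y x z : connected_component D x y -> connected_component D y z ->
  kob_comp D x z <= kob_comp D x y + kob_comp D y z.
Proof.
move=> xy yz; have xz := connected_component_trans xy yz.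
by rewrite /kob_comp -(same_connected_component xy); apply: kobD => //; exact: component_refl xy.
Qed.

Lemma kob_comp_local x y (r : R) : 0 < r -> rball x r `<=` D -> rnorm (y - x) <= r / 2 ->
  kob_comp D x y <= 2 / r * rnorm (y - x).
Proof.
move=> r0 xD yx; apply: (kob_local (oC (x := x)) (cC (x := x))) => //.
by apply: connected_component_max => //; [exact: rball_center|exact: connected_rball].
Qed.

End KobComp.

Lemma kob_comp_mono D D' x y : open D -> open D' -> D `<=` D' -> connected_component D x y ->
  kob_comp D' x y <= kob_comp D x y.
Proof.
move=> oD oD' DD xy; apply/ler_addgt0Pr => e e0.
have [s rs /ltW] := kob_comp_lt oD xy e0; apply: le_trans.
by apply: kob_comp_le => //; exact: reach_mono rs.
Qed.

Variables Omega U : set E.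
Let D := Omega `&` U.

(* [r] is a lower bound for the [lempert_tilde] distance from [z] to the complement of [U]. *)
Definition safe z (r : R) := forall phi, holomorphic_disc Omega phi -> phi 0 = z ->
  forall w, modulus w < r -> U (phi w).

Lemma safe_le z (r s : R) : r <= s -> safe z s -> safe z r.
Proof. by move=> rs h phi hphi p0 w wr; apply: h => //; exact: lt_le_trans rs. Qed.

Lemma safe_in z r : 0 < r -> Omega z -> safe z r -> D z.
Proof.
move=> r0 Oz h; split => //; apply: (h (fun=> z) _ (erefl _) 0); last by rewrite modulus0.
by move=> w _; split; [exact: derivable_cst|exact: Oz].
Qed.

Lemma safe_zoom phi (r : R) : 0 < r <= 1 -> holomorphic_disc Omega phi -> safe (phi 0) r ->
  holomorphic_disc (connected_component D (phi 0)) (fun w => phi (rc r * w)) /\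
  derive1 (fun w => phi (rc r * w)) 0 = rc r *: derive1 phi 0.
Proof.
move=> r01 h hs; have /andP[r0 r1] := r01.
have hD w : modulus w < r -> D (phi w).
  move=> wr; split; last exact: hs.
  by case: (h w) => //; apply/unit_discP; exact: lt_le_trans r1.
have [hz dz] := holo_zoom h r01 hD; split => //.
by have := holo_component hz (@disc0 R); rewrite mulr0.
Qed.

(** A disc of Omega centred at z, restricted to radius r and rescaled, becomes a disc of the
    component of D, at the price of a factor r in its derivative. *)
Lemma royden_localize z v (r : R) : 0 < r <= 1 -> safe z r ->
  (r%:E * kobayashi_royden (connected_component D z) z v <= kobayashi_royden Omega z v)%E.
Proof.
move=> r01 hs; have /andP[r0 r1] := r01.
apply: le_ereal_inf_tmp => _ [a [phi [h p0 av]] <-].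
rewrite -p0 in hs *; have [hz dz] := safe_zoom r01 h hs.
have := kobayashi_royden_le (a / rc r) hz.
rewrite dz scalerA divfK; last by apply/negP => /eqP/rc_inj r00; rewrite r00 ltxx in r0.
rewrite av mulr0 modulusM modulusV modulus_rc gtr0_norm// => k.
apply: le_trans (lee_wpmul2l _ k) _; first by rewrite lee_fin ltW.
by rewrite -EFinM lee_fin mulrCA divff ?mulr1// gt_eqF.
Qed.

Hypotheses (oO : open Omega) (oU : open U).
Let oD : open D. Proof. exact: openI. Qed.

(* Subdivide [a, b] into N pieces and let N tend to infinity: on a piece of length
   [k], localization replaces [k] by [artanh (th k / r)], which is [k / r + O(k ^ 2)]. *)
Let kob_localize_disc phi (a b c r : R) g : holomorphic_disc Omega phi -> 0 < r <= 1 -> a <= b ->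
  (forall t, a <= t <= b -> g t = phi (rc (th (t - c)))) ->
  (forall t, a <= t <= b -> safe (g t) r) ->
  connected_component D (g a) (g b) /\ kob_comp D (g a) (g b) <= (b - a) / r.
Proof.
move=> h r01 ab gE hs; have /andP[r0 r1] := r01.
have Ogt t : a <= t <= b -> D (g t).
  move=> tab; apply: (safe_in r0) (hs _ tab).
  by rewrite gE//; case: (h _ (disc_th (t - c))).
pose L := (b - a) / r.
have L0 : 0 <= L by rewrite divr_ge0 ?subr_ge0// ltW.
have step s (k : R) : 0 <= k -> k / r < 1 -> a <= s -> s + k <= b ->
    connected_component D (g s) (g (s + k)) /\
    kob_comp D (g s) (g (s + k)) <= k / r / (1 - k / r).
  move=> k0 kr as_ skb.
  have sab : a <= s <= b by apply/andP; split; lra.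
  have skab : a <= s + k <= b by apply/andP; split; lra.
  have [psi [hpsi psiE psi0 _]] := holo_shift (s - c) h.
  have gs : psi 0 = g s by rewrite psi0 gE.
  have gsk : psi (rc (th k)) = g (s + k).
    by rewrite psiE gE//; congr (phi (rc (th _))); ring.
  have hs' := hs _ sab; rewrite -gs in hs'.
  have [hz _] := safe_zoom r01 hpsi hs'.
  have thk0 : 0 <= th k by rewrite th_ge0.
  have x0 : 0 <= th k / r by rewrite divr_ge0// ltW.
  have xk : th k / r <= k / r by rewrite ler_pM2r ?invr_gt0// th_leid.
  have x1 : th k / r < 1 by exact: le_lt_trans kr.
  have := reach_holo hz (@disc_rc _ (th k / r) (ltac:(by rewrite ger0_norm))).
  rewrite mulr0 -rcM mulrCA divff ?gt_eqF// mulr1 gs gsk modulus_rc ger0_norm// => rch.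
  have rch' := reach_mono (@connected_component_sub _ _ _) rch.
  split; first exact: reach_connected rch'.
  apply: le_trans (kob_comp_le oD rch') _; apply: le_trans (artanh_upper x0 x1) _.
  by apply: ler_pM => //; [rewrite invr_ge0; lra | rewrite lef_pV2 ?posrE; lra].
have main e : 0 < e -> connected_component D (g a) (g b) /\ kob_comp D (g a) (g b) <= L + e.
  (* The N pieces cost L N / (N - L) together, which is at most L + e once L^2 <= e (N - L). *)
  move=> e0; pose N := (Num.truncn (L + L ^+ 2 / e)).+1.
  have NL : L + L ^+ 2 / e < N%:R by exact: truncnS_gt.
  have Le0 : 0 <= L ^+ 2 / e by rewrite divr_ge0 ?sqr_ge0// ltW.
  have N0 : 0 < N%:R :> R by rewrite ltr0n.
  pose k := (b - a) / N%:R.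
  have krE : k / r = L / N%:R by rewrite /k /L mulrAC.
  have kr : k / r < 1 by rewrite krE ltr_pdivrMr// mul1r; lra.
  have k0 : 0 <= k by rewrite divr_ge0 ?subr_ge0// ltW.
  have Nk : N%:R * k = b - a by rewrite /k mulrCA divff ?mulr1// gt_eqF.
  set q := k / r / (1 - k / r) in step.
  have ind i : (i <= N)%N -> connected_component D (g a) (g (a + i%:R * k)) /\
      kob_comp D (g a) (g (a + i%:R * k)) <= i%:R * (k / r / (1 - k / r)).
    elim: i => [_|i IH iN].
      rewrite mul0r addr0 mul0r; have Dga : D (g a) by apply: Ogt; rewrite lexx.
      split; first exact: connected_component_refl.
      exact: kob_comp_le (reach_refl Dga).
    have [c1 h1] := IH (ltnW iN).
    have i0 : 0 <= i%:R * k by rewrite mulr_ge0.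
    have iNk : i%:R * k + k <= b - a.
      rewrite -Nk -[X in _ + X]mul1r -mulrDl natr1 ler_wpM2r// ler_nat//.
    have [|| c2 h2] := step (a + i%:R * k) k k0 kr; [lra|lra|].
    have -> : a + i.+1%:R * k = a + i%:R * k + k by rewrite -natr1 mulrDl mul1r addrA.
    split; first exact: connected_component_trans c1 c2.
    apply: le_trans (kob_comp_tri oD c1 c2) _.
    by rewrite -natr1 mulrDl mul1r lerD.
  have [c1 h1] := ind N (leqnn _); rewrite Nk addrC subrK in c1 h1.
  split => //; apply: le_trans h1 _; rewrite krE.
  have NL' : 0 < N%:R - L by lra.
  have -> : N%:R * (L / N%:R / (1 - L / N%:R)) = L * N%:R / (N%:R - L).
    by field; rewrite !gt_eqF.
  rewrite ler_pdivrMr//.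
  have : L ^+ 2 <= e * (N%:R - L).
    have -> : L ^+ 2 = e * (L ^+ 2 / e) by rewrite mulrCA divff ?mulr1// gt_eqF.
    rewrite ler_wpM2l ?(ltW e0)//; lra.
  lra.
split; first by have [] := main 1 ltr01.
by apply/ler_addgt0Pr => e e0; have [] := main e e0.
Qed.

Lemma kob_localize g (a b r : R) : dpath Omega g a b -> 0 < r <= 1 ->
  (forall t, a <= t <= b -> safe (g t) r) ->
  connected_component D (g a) (g b) /\ kob_comp D (g a) (g b) <= (b - a) / r.
Proof.
move=> dg r01; elim: dg => [{}a {}b c phi ab h gE hs|{}a {}b c dab hab dbc hbc hs].
  exact: kob_localize_disc h r01 ab gE hs.
have ab := dpath_le dab; have bc := dpath_le dbc.
have [c1 h1] := hab (fun t tab => hs t (ltac:(by move: tab => /andP[-> /le_trans]; exact))).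
have [c2 h2] := hbc (fun t tbc => hs t (ltac:(by move: tbc => /andP[/(le_trans ab) -> ->]))).
split; first exact: connected_component_trans c1 c2.
apply: le_trans (kob_comp_tri oD c1 c2) _; apply: le_trans (lerD h1 h2) _.
by rewrite -mulrDl addrC addrA subrK.
Qed.

End Localize.


(** * Radii of discs that stay in U *)

Section Safe.
Context {R : realType} {n : nat}.
Local Notation E := 'rV[Cx R]_n.
Implicit Types (G D : set E) (phi : Cx R -> E) (g : R -> E) (x y z : E).

(** In the unbounded case, l_Omega(z, w) >= c > 0 for z near p and w of norm beyond M, so a disc
    centred near p cannot exceed norm M within radius tanh c. *)
Lemma hyperbolic_at_bound (Omega : set E) p : hyperbolic_at Omega p ->
  exists (W : set E) (M r : R), [/\ nbhs p W, 0 < r <= 1 &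
    forall phi, holomorphic_disc Omega phi -> W (phi 0) ->
    forall w, modulus w < r -> rnorm (phi w) <= M].
Proof.
move=> [/bounded_rnormP[M hM]|[_]].
  exists setT, M, 1; split; [exact: filterT|by rewrite ltr01 lexx|].
  by move=> phi h _ w w1; apply: hM; case: (h w) => //; exact/unit_discP.
rewrite limf_einfE => /ereal_sup_gt[_ [V FV <-] V0].
(* The infimum over V may be +oo; then 1 serves as c. *)
have [c c0 cV] : exists2 c : R, 0 < c & (c%:E <= ereal_inf ((fun zw : E * E => lempert Omega zw.1 zw.2) @` V))%E.
  move: V0; case: (ereal_inf _) => [c c0| _|//]; first by exists c.
  by exists 1; rewrite ?leey.
have [[A1 A2] /= [nA1 nA2] AV] := FV.
have [M hM] := (@bounded_rnormP R E (~` [set w | Omega w -> A2 w])).1 nA2.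
exists [set z | Omega z -> A1 z], M, (th c); split.
- exact: nA1.
- by rewrite ltW ?th_lt1// andbT -(@th0 R) th_lt.
move=> phi h A10 w wc; rewrite leNgt; apply/negP => Mw.
have w1 : unit_disc w by apply/unit_discP; exact: lt_trans wc (th_lt1 _).
have [_ O0] := h _ (@disc0 R); have [_ Ow] := h _ w1.
have A2w : A2 (phi w).
  by apply: contrapT => nA; have := hM (phi w) (fun f => nA (f Ow)); rewrite leNgt Mw.
have : (c%:E <= lempert Omega (phi 0%R) (phi w))%E.
  apply: le_trans cV _; apply: ereal_inf_lbound; exists (phi 0, phi w) => //.
  by apply: AV; split => //=; exact: A10.
move=> /le_trans/(_ (lempert_le h w1)); rewrite lee_fin -th_le th_artanh ?modulus_ge0//.
  by rewrite leNgt wc.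
rewrite (lt_le_trans _ (modulus_ge0 w)) ?ltrN10//=; exact/unit_discP.
Qed.

(** On radius r1 the discs centred near p are bounded, so the Schwarz bound applies: within radius
    rho they move by less than del, half the radius d of a ball around p inside U, and their centre
    is within del of p. *)
Lemma safe_uniform A (Omega U : set E) p : schwarz_bound (R := R) (n := n) A ->
  hyperbolic_at Omega p -> neighbourhood p U ->
  exists (W : set E) (r : R), [/\ neighbourhood p W, 0 < r <= 1 &
    forall z, Omega z -> W z -> safe Omega U z r].
Proof.
move=> [A0 hA] hp [oU Up].
have [W0 [M [r1 [nW0 r01 hM]]]] := hyperbolic_at_bound hp.
have [d d0 dU] := open_rballP oU Up.
pose M' := 2 * Num.max M 0 + 1.
have M'0 : 0 < M' by rewrite ltr_wpDl// mulr_ge0// le_max lexx orbT.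
pose del := d / 2.
have del0 : 0 < del by rewrite divr_gt0.
have AM0 : 0 < A * M' by rewrite mulr_gt0.
pose rho := th (del / (A * M')).
have rho0 : 0 < rho by rewrite -(@th0 R) th_lt divr_gt0.
have /andP[r10 r11] := r01.
exists (W0° `&` rball p del), (r1 * rho); split.
- split; first by apply: openI; [exact: open_interior | exact: open_rball].
  by split => //; exact: rball_center.
- rewrite mulr_gt0//=; apply: mulr_ile1 => //; try exact: ltW.
  exact/ltW/th_lt1.
move=> z Oz [/interior_subset W0z zp] phi h p0 w wr; apply: dU.
have [] := @holo_zoom _ _ Omega Omega phi r1 h r01.
  by move=> u u1; case: (h u) => //; apply/unit_discP; exact: lt_le_trans r11.
set psi := (fun u => _) => hpsi _.
have psi0 : psi 0 = z by rewrite /psi mulr0.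
have bnd u : unit_disc u -> rnorm (psi u) <= Num.max M 0.
  move=> /unit_discP u1; rewrite le_max; apply/orP; left; apply: (hM phi h (ltac:(by rewrite p0))).
  by rewrite modulusM modulus_rc gtr0_norm// -[ltRHS]mulr1 ltr_pM2l.
have hpsi' : holomorphic_disc (rball (psi 0) M') psi.
  move=> u u1; split; first by have [] := hpsi _ u1.
  have := bnd _ u1; have := bnd _ (@disc0 R); have := rnormB (psi u) (psi 0).
  by rewrite /rball /= /M'; lra.
pose u := (rc r1)^-1 * w.
have r1n : rc r1 != 0 by apply/eqP => /rc_inj; apply/eqP; rewrite gt_eqF.
have uw : psi u = phi w by rewrite /psi /u mulrA divff// mul1r.
have mu : modulus u < rho.
  by rewrite modulusM modulusV modulus_rc gtr0_norm// mulrC ltr_pdivrMr// mulrC.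
have u1 : unit_disc u by apply/unit_discP; exact: lt_trans mu (th_lt1 _).
have := hA _ _ M'0 hpsi' u u1; rewrite uw psi0 => hw.
have : artanh (modulus u) < del / (A * M').
  rewrite -th_lt th_artanh//.
  by rewrite (lt_le_trans _ (modulus_ge0 u)) ?ltrN10//=; exact/unit_discP.
rewrite ltr_pdivlMr// mulrC => hd.
rewrite /rball /= in zp *; have := rdistD z (phi w) p.
have : del + del = d by rewrite /del; lra.
lra.
Qed.

Section Weights.
Variables Omega U : set E.
Hypotheses (oO : open Omega) (cO : connected Omega) (oU : open U).
Let D := Omega `&` U.
Let oD : open D. Proof. exact: openI. Qed.

(** A disc centred at z that is outside U at w gives k_Omega(z, phi w) <= artanh |w|, hence |w| >=
    th x. *)
Lemma safe_far z (x : R) : (forall w, Omega w -> ~ U w -> x <= kobayashi Omega z w) ->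
  safe Omega U z (th x).
Proof.
move=> far phi h p0 w wx; apply: contrapT => Uw.
have w1 : unit_disc w by apply/unit_discP; exact: lt_trans wx (th_lt1 _).
have [_ Ow] := h _ w1.
have := far _ Ow Uw; rewrite -p0 => /le_trans/(_ (kob_le oO cO (reach_holo h w1))).
rewrite -th_le th_artanh; first by rewrite leNgt wx.
by rewrite (lt_le_trans _ (modulus_ge0 w)) ?ltrN10//=; exact/unit_discP.
Qed.

Lemma safe_weight (r0 : R) : 0 < r0 <= 1 -> exists2 C : R, 0 <= C & forall z (x : R),
  safe Omega U z r0 -> (forall w, Omega w -> ~ U w -> x <= kobayashi Omega z w) ->
  safe Omega U z (1 + C * expR (- (2 * x)))^-1.
Proof.
(* For x >= 1 and X = exp (2 x), the claim (X + 1) / (X - 1) <= 1 + C / X means 2 <= C (1 - 1 / X),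
   true as C and X are at least 3. For x < 1 the summand e^2 / r0 makes C exp (- 2 x) at least 1 /
   r0, and the radius r0 suffices. *)
move=> /andP[r00 r01]; pose C := expR 2 / r0 + 3.
have e2 : 3 <= expR (2 : R) by have := expR_ge1Dx (2 : R); lra.
have q0 : 0 < expR 2 / r0 by rewrite divr_gt0// expR_gt0.
have C0 : 0 <= C by rewrite /C; lra.
exists C => // z x sr0 far.
have Ex0 := expR_gt0 (2 * x); have EN : expR (- (2 * x)) = (expR (2 * x))^-1 by rewrite expRN.
have P0 : 0 < 1 + C * expR (- (2 * x)).
  by rewrite ltr_pwDl// mulr_ge0// expR_ge0.
have [x1|x1] := leP 1 x.
  apply: safe_le (safe_far far).
  have E3 : 3 <= expR (2 * x) by apply: le_trans e2 _; rewrite ler_expR; lra.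
  rewrite /th EN; rewrite EN in P0; set X := expR (2 * x) in E3 Ex0 P0 *.
  have X1 : 0 < X + 1 by lra.
  rewrite ler_pdivlMr// mulrC ler_pdivrMr//.
  have -> : (X - 1) * (1 + C * X^-1) = X - 1 + C * (1 - X^-1) by field; rewrite gt_eqF.
  have : X^-1 <= 3^-1 by rewrite lef_pV2 ?posrE//; lra.
  have C3 : 3 <= C by rewrite /C; lra.
  nra.
apply: safe_le sr0.
rewrite -[leRHS]invrK lef_pV2 ?posrE ?invr_gt0//.
have h1 : expR 2 / r0 * expR (- (2 * x)) <= C * expR (- (2 * x)).
  by rewrite ler_wpM2r ?expR_ge0// /C; lra.
have h2 : r0^-1 <= expR 2 / r0 * expR (- (2 * x)).
  rewrite mulrAC -expRD ler_peMl ?invr_ge0 ?(ltW r00)//.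
  have := expR_ge1Dx (2 + - (2 * x)); lra.
lra.
Qed.

Lemma kob_weight g (a b t0 C : R) : dpath Omega g a b -> a <= t0 <= b -> 0 <= C ->
  (forall t, a <= t <= b -> safe Omega U (g t) (1 + C * expR (- `|t - t0|))^-1) ->
  connected_component D (g a) (g b) /\ kob_comp D (g a) (g b) <= (b - a) + 4 * C.
Proof.
move=> dg t0ab C0 hs.
have r01 m : 0 < (1 + C * expR (- m))^-1 <= 1.
  have p0 : 0 <= C * expR (- m) by rewrite mulr_ge0// expR_ge0.
  rewrite invr_gt0 ltr_wpDr//= invf_le1; last by rewrite ltr_wpDr.
  by rewrite lerDl.
have key s t m : a <= s -> s <= t -> t <= b -> 0 <= m ->
    (forall u, s <= u <= t -> m <= `|u - t0|) ->
    connected_component D (g s) (g t) /\ kob_comp D (g s) (g t) <= (1 + C * expR (- m)) * (t - s).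
  move=> as_ st tb m0 hm.
  have [] := @kob_localize _ _ Omega U oO oU g s t _ (dpath_sub dg as_ st tb) (r01 m).
    move=> u /andP[su ut]; have uab : a <= u <= b by apply/andP; split; lra.
    apply: safe_le (hs _ uab).
    rewrite lef_pV2 ?posrE ?ltr_pwDl ?mulr_ge0 ?expR_ge0//.
    by rewrite lerD2l ler_wpM2l// ler_expR lerN2 hm// su.
  by move=> c1; rewrite invrK mulrC.
have conn s t : a <= s -> s <= t -> t <= b -> connected_component D (g s) (g t).
  by move=> as_ st tb; have [] := key s t 0 as_ st tb (lexx _) (fun u _ => normr_ge0 _).
have ab := dpath_le dg.
split; first exact: conn.
apply: (@sum_decay _ (fun s t => kob_comp D (g s) (g t)) a b t0 C) => //.
  move=> s t u as_ st tu ub; apply: kob_comp_tri => //; apply: conn => //; lra.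
by move=> s t m as_ st tb m0 hm; have [] := key s t m as_ st tb m0 hm.
Qed.

End Weights.
End Safe.


(** * Exit times and geodesics *)

Section Curves.
Context {R : realType} {n : nat}.
Local Notation E := 'rV[Cx R]_n.
Implicit Types (G D : set E) (phi : Cx R -> E) (g : R -> E) (x y z : E).

Definition cont_curve (a b : R) g := forall t, a <= t <= b -> forall e : R, 0 < e ->
  exists2 d : R, 0 < d & forall s, a <= s <= b -> `|s - t| < d -> rnorm (g s - g t) < e.

Lemma rnorm_lt x (e : R) : 0 < e -> (forall j, modulus (x 0 j) < e) -> rnorm x < e.
Proof.
move=> e0 hx; rewrite -ltr_rc -rnormE [`|x|]mx_normE.
elim/big_ind : _ => [|u v u1 v1|[i j] _] /=; first by rewrite ltr_rc.
- by rewrite /Num.max; case: ifP.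
- by rewrite ord1 normE ltr_rc.
Qed.

Lemma lip_cont g (a b : R) : lip_curve g a b -> cont_curve a b g.
Proof.
move=> [L L0 hL] t tab e e0; have L1 : 0 < L + 1 by rewrite ltr_wpDl.
exists (e / (L + 1)); first by rewrite divr_gt0.
move=> s sab; rewrite ltr_pdivlMr// => st; apply: le_lt_trans (hL s t sab tab) _.
have := normr_ge0 (s - t); lra.
Qed.

Lemma ac_eps (f : R -> R) (a b t e : R) : absolutely_continuous a b f -> a <= t <= b -> 0 < e ->
  exists2 d : R, 0 < d & forall s, a <= s <= b -> `|s - t| < d -> `|f s - f t| < e.
Proof.
move=> hf /andP[at_ tb] e0; have [d d0 hd] := hf e e0; exists d => // s /andP[as_ sb] st.
have [st'|/ltW ts] := leP s t.
  have := hd [:: (s, t)]; rewrite /= !big_seq1 /= as_ st' tb => /(_ isT isT).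
  by rewrite distrC; apply; move: st; rewrite distrC ger0_norm ?subr_ge0.
have := hd [:: (t, s)]; rewrite /= !big_seq1 /= at_ ts sb => /(_ isT isT).
by apply; move: st; rewrite ger0_norm ?subr_ge0.
Qed.

Lemma acc_cont g (a b : R) : absolutely_continuous_curve a b g -> cont_curve a b g.
Proof.
move=> hg t tab e e0; have e2 : 0 < e / 2 by rewrite divr_gt0.
have : forall j : 'I_n, \forall d \near (0 : R)^'+, forall s, a <= s <= b -> `|s - t| < d ->
    modulus (g s 0 j - g t 0 j) < e.
  move=> j; have [hr hi] := hg j.
  have [d1 d10 h1] := ac_eps hr tab e2; have [d2 d20 h2] := ac_eps hi tab e2.
  have d0 : 0 < Num.min d1 d2 by rewrite lt_min d10.
  near=> d => s sab sd.
  have : d < Num.min d1 d2 by near: d; exact: nbhs_right_lt.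
  rewrite lt_min => /andP[dd1 dd2].
  have := h1 s sab (lt_trans sd dd1); have := h2 s sab (lt_trans sd dd2).
  case: (g s 0 j) => a1 b1; case: (g t 0 j) => a2 b2 /= hb ha.
  have -> : Complex a1 b1 - Complex a2 b2 = rc (a1 - a2) + Complex 0 1 * rc (b1 - b2) :> Cx R.
    by apply/eqP; rewrite eq_complex /=; apply/andP; split; apply/eqP; ring.
  apply: le_lt_trans (modulusD _ _) _; rewrite modulusM !modulus_rc.
  have -> : modulus (Complex 0 1 : Cx R) = 1.
    by rewrite /modulus /= expr0n /= add0r expr1n sqrtr1.
  by rewrite mul1r [ltRHS](splitr e) ltrD.
move=> /filter_forall hj.
near (0 : R)^'+ => d; exists d => // s sab sd.
apply: rnorm_lt => // j; rewrite !mxE.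
by move: j s sab sd; near: d; exact: hj.
Unshelve. all: by end_near. Qed.

Lemma cont_connected g (a b : R) D : cont_curve a b g -> (forall t, a <= t <= b -> D (g t)) ->
  forall s t, a <= s <= b -> a <= t <= b -> connected_component D (g s) (g t).
Proof.
move=> cg gD s t sab tab.
apply: (@connected_component_max _ _ (g @` `[a, b])).
- by exists s => //; rewrite /= in_itv.
- by move=> _ [u + <-]; rewrite /= in_itv /= => /gD.
- apply: connected_continuous_connected; first exact: segment_connected.
  apply/subspace_continuousP => u; rewrite /= in_itv /= => uab.
  apply/cvgrPdist_lt => e /gt0_rc[-> e0]; have [d d0 hd] := cg u uab _ e0.
  apply/nbhs_ballP; exists d => // v; rewrite /ball /= in_itv /= => uv vab.
  by rewrite distrC rnormE ltr_rc; apply: hd => //; rewrite distrC.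
- by exists t => //; rewrite /= in_itv.
Qed.

(** The exit time is the infimum of the times outside the open set W, so g t itself lies outside W
    and only in its closure. *)
Lemma first_exit g (a b : R) W : cont_curve a b g -> a <= b -> open W -> W (g a) -> ~ W (g b) ->
  exists t, [/\ a <= t <= b, ~ W (g t) & forall s, a <= s <= t -> closure W (g s)].
Proof.
move=> cg ab oW Wa Wb; pose S := [set t | a <= t <= b /\ ~ W (g t)].
have Sb : S b by split => //; rewrite ab lexx.
have iS : has_inf S by split; [exists b | exists a => t [/andP[]]].
pose t := inf S.
have at_ : a <= t by apply: lb_le_inf; [exists b | move=> u [/andP[]]].
have tb : t <= b by apply: ge_inf => //; case: iS.
have before s : a <= s -> s < t -> W (g s).
  move=> as_ st; apply: contrapT => Ws.
  suff : t <= s by rewrite leNgt st.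
  by apply: ge_inf; [case: iS | split => //; rewrite as_ (le_trans (ltW st))].
have tab : a <= t <= b by rewrite at_.
have nWt : ~ W (g t).
  move=> /(open_rballP oW)[r r0 rW]; have [d d0 hd] := cg t tab _ r0.
  have [u [uab Wu] ut] := inf_adherent d0 iS.
  have tu : t <= u by apply: ge_inf; [case: iS | split].
  by apply/Wu/rW/hd => //; rewrite ger0_norm ?subr_ge0//; lra.
exists t; split => // s /andP[as_]; rewrite le_eqVlt => /orP[/eqP ->|st]; last first.
  by apply: subset_closure; exact: before.
apply/closureP => e e0; have [d d0 hd] := cg t tab _ e0.
have lt_at : a < t by rewrite lt_neqAle at_ andbT; apply/eqP => at_E; apply: nWt; rewrite -at_E.
pose u := Num.max a (t - d / 2).
have ut : u < t by rewrite gt_max lt_at /=; lra.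
have au : a <= u by rewrite le_max lexx.
exists (g u); first exact: before.
apply: hd; first by rewrite au (le_trans (ltW ut)).
rewrite distrC ger0_norm ?subr_ge0 ?(ltW ut)//.
have : t - d / 2 <= u by rewrite le_max lexx orbT.
lra.
Qed.

Section Bounds.
Variable D : set E.
Hypothesis oD : open D.

(** K may meet several components of D, so f is 0 on pairs from different ones. Near a given pair
    each end point contributes at most 1 to the variation. *)
Lemma kob_comp_bounded K : compact K -> K `<=` D ->
  exists M : R, forall x y, K x -> K y -> connected_component D x y -> kob_comp D x y <= M.
Proof.
move=> cK KD; pose f (xy : E * E) := if pselect (connected_component D xy.1 xy.2) then
  kob_comp D xy.1 xy.2 else 0.
have [|M hM] := @compact_bound R (E * E)%type (K `*` K) f (compact_setX cK cK); last first.
  exists M => x y Kx Ky xy; have := hM (x, y) (conj Kx Ky); rewrite /f /=.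
  by case: pselect.
move=> [x y] [/= Kx Ky].
have [r r0 rD] := open_rballP oD (KD _ Kx); have [s s0 sD] := open_rballP oD (KD _ Ky).
have near u v (q : R) : 0 < q -> rball u q `<=` D -> rnorm (v - u) < q / 2 ->
    connected_component D u v /\ kob_comp D u v <= 1.
  move=> q0 qD vu; have vq : rnorm (v - u) < q by have := rnorm_ge0 (v - u); lra.
  split; first exact: reach_connected (reach_local q0 qD vq).
  apply: le_trans (kob_comp_local oD q0 qD (ltW vu)) _.
  by rewrite mulrAC ler_pdivrMr// mul1r; lra.
exists (Num.max 0 (kob_comp D x y + 2)).
exists (rball x (r / 2), rball y (s / 2)).
  by split; apply/nbhs_rnormP; [exists (r / 2) | exists (s / 2)] => //; rewrite divr_gt0.
move=> [u v] [/= ux vy]; rewrite /f /=; case: pselect => uv; last by rewrite le_max lexx.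
have [xu ku] := near x u r r0 rD ux; have [yv kv] := near y v s s0 sD vy.
have ux' := connected_component_sym xu; have vy' := connected_component_sym yv.
have xy := connected_component_trans xu (connected_component_trans uv vy').
rewrite le_max; apply/orP; right.
have h1 := kob_comp_tri oD ux' (connected_component_trans xy yv).
have h2 := kob_comp_tri oD xy yv.
rewrite -(kob_comp_sym oD xu) in h1; lra.
Qed.

Lemma dpath_near_min g (a b e : R) : dpath D g a b -> b - a <= kob_comp D (g a) (g b) + e ->
  forall s t, a <= s -> s <= t -> t <= b -> t - s <= kob_comp D (g s) (g t) + e.
Proof.
move=> dg h s t as_ st tb.
have r1 := dpath_reach (dpath_sub dg (lexx _) as_ (le_trans st tb)).
have r2 := dpath_reach (dpath_sub dg as_ st tb).
have r3 := dpath_reach (dpath_sub dg (le_trans as_ st) tb (lexx _)).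
have c1 := reach_connected r1; have c2 := reach_connected r2; have c3 := reach_connected r3.
have k1 := kob_comp_le oD r1; have k3 := kob_comp_le oD r3.
have k4 := kob_comp_tri oD c1 (connected_component_trans c2 c3).
have k5 := kob_comp_tri oD c2 c3.
lra.
Qed.

Lemma near_geodesic A x y (e : R) : schwarz_bound (R := R) (n := n) A ->
  connected_component D x y -> 0 < e ->
  exists g (S : R), [/\ g 0 = x, g S = y, dpath D g 0 S, S < kob_comp D x y + e &
    geodesic 1 e D 0 S g].
Proof.
move=> hA xy e0; have [S [g [dg g0 gS]] hS] := kob_comp_lt oD xy e0.
exists g, S; split => //; apply: (dpath_geodesic hA) => //.
by rewrite subr0 -/(kob_comp D _ _) g0 gS ltW.
Qed.

End Bounds.

Lemma geodesic_sub (lam e a b c : R) D g : geodesic lam e D a b g -> a <= c -> c <= b ->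
  geodesic lam e D a c g.
Proof.
move=> [ab gD acg hg] ac cb; split => //.
- by move=> t /andP[at_ tc]; apply: gD; rewrite at_ (le_trans tc).
- move=> j; have [hr hi] := acg j.
  have sub f : absolutely_continuous a b f -> absolutely_continuous a c f.
    move=> hf eps eps0; have [d d0 hd] := hf eps eps0; exists d => // s hs; apply: hd.
    apply: sub_all hs => J /and3P[-> -> Jc]; exact: le_trans Jc cb.
  by split; exact: sub.
- by move=> t1 t2 at1 t12 t2c; apply: hg => //; exact: le_trans cb.
Qed.

Lemma geodesic_weaken (lam lam' e e' a b : R) D g : open D ->
  geodesic lam e D a b g -> lam <= lam' -> e <= e' -> geodesic lam' e' D a b g.
Proof.
move=> oD [ab gD acg hg] ll ee; split => // s t as_ st tb.
apply: le_trans (hg _ _ as_ st tb) _; rewrite lee_fin lerD// ler_wpM2r//.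
apply: kob_comp_ge0 => //; apply: (cont_connected (acc_cont acg) gD).
  by rewrite as_ (le_trans st).
by rewrite tb (le_trans as_).
Qed.

Lemma visible_weaken (lam lam' e e' : R) D p : open D -> lam' <= lam -> e' <= e ->
  visible_point_eps lam e D p -> visible_point_eps lam' e' D p.
Proof.
move=> oD ll ee h U nU bU; have [V [K [nV rV cK KD hK]]] := h U nU bU.
exists V, K; split => // a b g gg; apply: hK; exact: geodesic_weaken gg ll ee.
Qed.

End Curves.


(** * Consequences of visibility *)

Section ExteriorEstimate.
Context {R : realType} {n : nat}.
Local Notation E := 'rV[Cx R]_n.
Implicit Types (phi : Cx R -> E) (g : R -> E) (x y z : E).

Lemma neighbourhood_ball (p : E) (W : set E) : neighbourhood p W ->
  exists W', [/\ neighbourhood p W', bounded_set W', closure W' `<=` W & W' `<=` W].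
Proof.
move=> [oW Wp]; have [r r0 rW] := open_rballP oW Wp.
have r2 : 0 < r / 2 by rewrite divr_gt0.
have cW : closure (rball p (r / 2)) `<=` W.
  by move=> y /closure_rball /= yp; apply: rW; rewrite /rball /=; lra.
exists (rball p (r / 2)); split => //.
- by split; [exact: open_rball | exact: rball_center].
- apply/bounded_rnormP; exists (r / 2 + rnorm p) => y; rewrite /rball /= => yp.
  have := rnormD (y - p) p; rewrite subrK; lra.
- by move=> y yp; apply/cW/subset_closure.
Qed.

Lemma neighbourhoodI (p : E) (V W : set E) : neighbourhood p V -> neighbourhood p W ->
  neighbourhood p (V `&` W).
Proof. by move=> [oV Vp] [oW Wp]; split => //; exact: openI. Qed.

Variables (A : R) (Omega U : set E) (p o : E).
Hypotheses (hA : schwarz_bound (R := R) (n := n) A) (oO : open Omega) (cO : connected Omega).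
Hypotheses (hp : hyperbolic_at Omega p) (nU : neighbourhood p U) (bU : bounded_set U) (Oo : Omega o).
Let D := Omega `&` U.
Let oU : open U. Proof. by case: nU. Qed.
Let oD : open D. Proof. exact: openI. Qed.
Local Notation k := (kobayashi Omega).

Let OO x y : Omega x -> Omega y -> connected_component Omega x y.
Proof. by move=> Ox Oy; rewrite connected_component_id. Qed.

Let kE x y : Omega x -> kob_comp Omega x y = k x y.
Proof. exact: kob_compE. Qed.

Lemma kob_bounded_from K : compact K -> K `<=` Omega ->
  exists2 M : R, 0 <= M & forall x, K x -> k x o <= M.
Proof.
move=> cK KO; have [||M hM] := @kob_comp_bounded _ _ Omega oO (K `|` [set o]).
- by apply: compactU => //; exact: compact_set1.
- by move=> x [/KO//|->].
have M0 : 0 <= M.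
  by have := hM o o (or_intror erefl) (or_intror erefl) (OO Oo Oo); rewrite kE// kobxx.
exists M => // x Kx; have Ox := KO _ Kx.
by have := hM x o (or_introl Kx) (or_intror erefl) (OO Ox Oo); rewrite kE.
Qed.

Definition exterior_estimate := exists (V : set E) (C : R), neighbourhood p V /\
  forall z w, Omega z -> V z -> Omega w -> ~ U w -> k z o <= k z w + C.

(** A nearly shortest chain from z to w is a geodesic, hence meets K, whose points are within M of
    o. *)
Lemma exterior_estimate_global : visible_point_eps 1 1 Omega p -> exterior_estimate.
Proof.
move=> /(_ U nU bU)[V [K [nV rV cK KO hK]]].
have [M M0 hM] := kob_bounded_from cK KO.
exists V, (M + 1); split => // z w Oz Vz Ow Uw.
have [g [S [g0 gS dg SE gg]]] := near_geodesic oO hA (OO Oz Ow) ltr01.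
have [||t tS Kt] := hK 0 S g gg; [by rewrite g0 | by rewrite gS|].
have /andP[t0 tS'] := tS.
have Ot := KO _ Kt.
have k1 := kob_le oO cO (dpath_reach (dpath_sub dg (lexx _) t0 tS')).
rewrite g0 subr0 in k1; rewrite kE// in SE.
have k2 := kobD oO cO Oz Ot Oo; have := hM _ Kt; lra.
Qed.

Let closure_sub (V W : set E) : relatively_compact_in V W -> V `<=` W.
Proof. by move=> [_ VW] y Vy; exact/VW/subset_closure. Qed.

(* Follow a nearly shortest chain of Omega from [z] to the exterior of a small ball
   [W1]: at time [s] before the exit time [t] its distance to the exterior is at
   least [t - s - 2], so localizing it to D costs a bounded amount.  The exit point
   is then far from [z] for D as well, where visibility applies. *)
Lemma exterior_estimate_local : visible_point_eps 1 1 D p -> exterior_estimate.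
Proof.
move=> vis.
have [W [r0 [nW r01 sW]]] := safe_uniform hA hp nU.
have [C C0 hC] := @safe_weight _ _ Omega U oO cO r0 r01.
(* The closure of W1 lies in W and in U: the radius r0 is available up to the exit time, and the
   exit point is still in U. *)
have [W1 [nW1 bW1 cW1 _]] := neighbourhood_ball (neighbourhoodI nW nU).
have [V [K [nV rV cK KD hK]]] := vis W1 nW1 bW1.
have VW1 := closure_sub rV.
have KO : K `<=` Omega by move=> x /KD[].
have [M M0 hM] := kob_bounded_from cK KO.
(* Comes from exp (- 2 (t - s - 2)) <= exp 4 exp (- (t - s)); the inner 2 is one unit lost in
   choosing w1 and one in the length of the chain. *)
pose C' := C * expR 4.
have C'0 : 0 <= C' by rewrite mulr_ge0// expR_ge0.
(* The chain in D to the exit point is shorter than t + 4 C' + 1, with t < d + 2 and d <= k z w; M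
   leads from K to o. *)
exists V, (M + 3 + 4 * C'); split => // z w Oz Vz Ow Uw.
pose S0 := [set k z w' | w' in [set w' | Omega w' /\ ~ W1 w']].
have W1U w' : ~ U w' -> ~ W1 w'.
  by move=> Uw' /subset_closure/cW1[].
have iS0 : has_inf S0.
  split; first by exists (k z w); exists w => //; split => //; exact: W1U.
  by exists 0 => _ [w' [Ow' _] <-]; exact: kob_ge0.
have [_ [w1 [Ow1 Ww1] <-] w1E] := inf_adherent ltr01 iS0.
set d := inf S0 in w1E.
have dle w' : Omega w' -> ~ W1 w' -> d <= k z w'.
  by move=> Ow' Ww'; apply: ge_inf; [case: iS0 | exists w'].
have [g [S [g0 gS dg SE _]]] := near_geodesic oO hA (OO Oz Ow1) ltr01.
rewrite kE// in SE.
have gO := dpath_in dg.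
have [t [tS Wt gW]] := first_exit (lip_cont (dpath_lipschitz hA dg)) (dpath_le dg) nW1.1
  (ltac:(by rewrite g0; exact: VW1)) (ltac:(by rewrite gS)).
have /andP[t0 tS'] := tS.
have dgt := dpath_sub dg (lexx _) t0 tS'.
have [] := @kob_weight _ _ Omega U oO oU g 0 t t C' dgt (ltac:(by rewrite t0 lexx)) C'0.
  move=> s /andP[s0 st].
  have sS : 0 <= s <= S by rewrite s0 (le_trans st).
  have [Ws Us] := cW1 _ (gW s (ltac:(by rewrite s0))).
  have Os := gO s sS.
  have hx : safe Omega U (g s) (1 + C * expR (- (2 * (t - s - 2))))^-1.
    apply: hC; first exact: sW.
    move=> w' Ow' /W1U Ww'.
    have h1 := dle w' Ow' Ww'; have h2 := kobD oO cO Oz Os Ow'.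
    have h3 := kob_le oO cO (dpath_reach (dpath_sub dg (lexx _) s0 (le_trans st tS'))).
    by rewrite g0 subr0 in h3; lra.
  apply: safe_le hx; rewrite lef_pV2 ?posrE ?ltr_pwDl ?mulr_ge0 ?expR_ge0//.
  rewrite lerD2l /C' -mulrA ler_wpM2l// -expRD ler_expR ler0_norm; last lra.
  lra.
rewrite g0 subr0 => c1 k1.
have Dgt : D (g t) by exact: connected_component_sub c1.
have [g' [S' [g'0 g'S dg' S'E gg']]] := near_geodesic oD hA c1 ltr01.
have Dz : D z by exact: connected_component_sub (component_refl c1).
have [||u uS Ku] := hK 0 S' g' gg'; [by rewrite g'0 | by rewrite g'S |].
have /andP[u0 uS'] := uS.
have Ou := KO _ Ku.
have DO : D `<=` Omega by move=> ? [].
have k2 := kob_le oO cO (reach_mono DO (dpath_reach (dpath_sub dg' (lexx _) u0 uS'))).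
rewrite g'0 subr0 in k2.
have k3 := kobD oO cO Oz Ou Oo; have k4 := hM _ Ku.
have k5 := dle w Ow (W1U _ Uw).
rewrite -/D in k1 S'E; lra.
Qed.

Lemma safe_of_exterior_estimate : exterior_estimate ->
  exists (V : set E) (C : R), [/\ neighbourhood p V, V `<=` U, 0 <= C &
  forall z, Omega z -> V z -> safe Omega U z (1 + C * expR (- (2 * k z o)))^-1].
Proof.
move=> [V [C1 [nV hV]]].
have [W [r0 [nW r01 sW]]] := safe_uniform hA hp nU.
have [C C0 hC] := @safe_weight _ _ Omega U oO cO r0 r01.
exists (V `&` W `&` U), (C * expR (2 * C1)); split.
- exact: neighbourhoodI (neighbourhoodI nV nW) nU.
- by move=> ? [].
- by rewrite mulr_ge0// expR_ge0.
move=> z Oz [[Vz Wz] _]; rewrite -mulrA -expRD.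
have -> : 2 * C1 + - (2 * k z o) = - (2 * (k z o - C1)) by ring.
apply: hC; first exact: sW.
by move=> w Ow Uw; have := hV z w Oz Vz Ow Uw; lra.
Qed.

Section Additive.
Variables (V : set E) (C : R).
Hypotheses (nV : neighbourhood p V) (VU : V `<=` U) (C0 : 0 <= C).
Hypothesis hV : forall z, Omega z -> V z -> safe Omega U z (1 + C * expR (- (2 * k z o)))^-1.

(** Let t0 be the time closest to o, up to 1. Near-minimality and the triangle inequality through o
    give |t - t0| <= 2 k(g t, o) + 2, so exp (- 2 k(g t, o)) is at most exp 2 exp (- |t - t0|), the
    decay in time that [kob_weight] asks for. *)
Lemma kob_comp_along g (a b : R) : dpath Omega g a b ->
  (forall s t, a <= s -> s <= t -> t <= b -> t - s <= k (g s) (g t) + 1) ->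
  (forall t, a <= t <= b -> V (g t)) ->
  connected_component D (g a) (g b) /\ kob_comp D (g a) (g b) <= b - a + 4 * (C * expR 2).
Proof.
move=> dg near gV; have gO := dpath_in dg; have ab := dpath_le dg.
pose S0 := [set k (g t) o | t in [set t | a <= t <= b]].
have iS0 : has_inf S0.
  split; first by exists (k (g a) o); exists a => //=; rewrite lexx.
  by exists 0 => _ [t tab <-]; apply: kob_ge0 => //; exact: gO.
have [_ [t0 t0ab <-] t0E] := inf_adherent ltr01 iS0.
apply: (@kob_weight _ _ Omega U oO oU g a b t0) => //.
  by rewrite mulr_ge0// expR_ge0.
move=> t tab; apply: safe_le (hV (gO _ tab) (gV _ tab)).
have Ot := gO _ tab; have Ot0 := gO _ t0ab.
have t0le : k (g t0) o <= k (g t) o + 1.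
  apply: le_trans (ltW t0E) _; rewrite lerD2r; apply: ge_inf; first by case: iS0.
  by exists t.
rewrite lef_pV2 ?posrE ?ltr_pwDl ?mulr_ge0 ?expR_ge0//.
rewrite lerD2l -mulrA ler_wpM2l// -expRD ler_expR.
have tri : `|t - t0| <= k (g t) (g t0) + 1.
  have /andP[at_ tb] := tab; have /andP[at0 t0b] := t0ab.
  have [tt0|/ltW t0t] := leP t t0.
    by rewrite ler0_norm ?subr_le0// opprB; exact: near.
  by rewrite ger0_norm ?subr_ge0// kobC//; exact: near.
have := kobD oO cO Ot Oo Ot0; rewrite (kobC oO cO Oo Ot0); lra.
Qed.

(* Either a nearly minimal chain from [x] to [y] stays close to [p] and can be
   localized, or it meets the compact set given by visibility before leaving [W]. *)
Let localize_or_meet (W' W K : set E) : closure W `<=` V -> open W -> W' `<=` W ->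
  (forall (a b : R) g, geodesic 1 1 Omega a b g -> (Omega `&` W') (g a) -> (Omega `\` W) (g b) ->
     exists2 t, a <= t <= b & K (g t)) ->
  forall x y, Omega x -> W' x -> Omega y ->
  (connected_component D x y /\ kob_comp D x y <= k x y + 1 + 4 * (C * expR 2)) \/
  exists q t, [/\ K q /\ closure W q, connected_component D x q,
    kob_comp D x q <= t + 4 * (C * expR 2), t <= k x q + 1 & t + k q y <= k x y + 1].
Proof.
move=> cWV oW W'W hK x y Ox W'x Oy; have Wx := W'W _ W'x.
have [g [S [g0 gS dg SE gg]]] := near_geodesic oO hA (OO Ox Oy) ltr01.
have gO := dpath_in dg; have S0 := dpath_le dg.
have near s t : 0 <= s -> s <= t -> t <= S -> t - s <= k (g s) (g t) + 1.
  move=> s0 st tS; rewrite -kE; last by apply: gO; rewrite s0 (le_trans st).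
  by apply: (dpath_near_min oO dg) => //; rewrite g0 gS subr0 ltW.
rewrite kE// in SE.
have [allW|] := pselect (forall t, 0 <= t <= S -> W (g t)).
  left; have [] := kob_comp_along dg near _.
    by move=> t /allW Wt; apply/cWV/subset_closure.
  by rewrite g0 gS subr0 => c1 k1; split => //; lra.
move=> /existsNP[b /not_implyP[/andP[b0 bS] Wb]]; right.
have dgb := dpath_sub dg (lexx _) b0 bS.
have [t [/andP[t0 tb] Wt gW]] := first_exit (lip_cont (dpath_lipschitz hA dgb)) b0 oW
  (ltac:(by rewrite g0)) Wb.
have tS := le_trans tb bS.
have [||q qt Kq] := hK 0 t g (geodesic_sub gg t0 tS).
- by rewrite g0.
- by split => //; apply: gO; rewrite t0.
have /andP[q0 qt'] := qt; have qS := le_trans qt' tS.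
have [] := kob_comp_along (dpath_sub dg (lexx _) q0 qS) _ _.
- by move=> s u s0 su uq; apply: near => //; exact: le_trans qS.
- by move=> s /andP[s0 sq]; apply/cWV/gW; rewrite s0 (le_trans sq).
rewrite g0 subr0 => c1 k1; exists (g q), q; split => //.
- by split => //; exact: gW.
- by have := near 0 q (lexx _) q0 qS; rewrite g0 subr0.
- have := kob_le oO cO (dpath_reach (dpath_sub dg q0 qS (lexx _))).
  have := near 0 S (lexx _) S0 (lexx _); rewrite g0 gS; lra.
Qed.

(** If the chain from x or the one from y stays near p, it localizes as a whole. Otherwise x is
    joined in D to a point q of K3 and y to a point q', and q, q' are at bounded distance in D; they
    share a component because x and y do. *)
Lemma kob_additive : visible_point_eps 1 1 Omega p -> exists (W : set E) (M : R),
  [/\ neighbourhood p W, W `<=` V, 0 <= M & forall x y, W x -> W y ->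
    connected_component D x y -> kob_comp D x y <= k x y + M].
Proof.
move=> vis; have [W1 [nW1 bW1 cW1 _]] := neighbourhood_ball nV.
have [W2 [K [nW2 rW2 cK KO hK]]] := vis W1 nW1 bW1.
have W21 := closure_sub rW2.
pose K3 := K `&` closure W1.
have cK3 : compact K3 by apply: compact_closedI => //; exact: closed_closure.
have K3D : K3 `<=` D by move=> q [/KO Oq /cW1/VU Uq].
have [M hM] := kob_comp_bounded oD cK3 K3D.
have K3O : K3 `<=` Omega by move=> q [/KO].
have [M' hM'] := kob_comp_bounded oO cK3 K3O.
pose C4 := 4 * (C * expR 2).
have C40 : 0 <= C4 by rewrite mulr_ge0// mulr_ge0// expR_ge0.
(* The times satisfy t + t' <= k x y + 2 + k q q', through k y q' <= k y q + k q q'. M bounds the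
   distance of q and q' in D, M' the one in Omega, and each localized end costs C4. *)
exists W2, (Num.max M 0 + Num.max M' 0 + 2 + 2 * C4).
have m0 : 0 <= Num.max M 0 by rewrite le_max lexx orbT.
have m'0 : 0 <= Num.max M' 0 by rewrite le_max lexx orbT.
split => //; [by move=> z /W21 W1z; apply/cW1/subset_closure | lra |].
move=> x y W2x W2y xy.
have [Ox _] := connected_component_sub (component_refl xy).
have [Oy _] := connected_component_sub xy.
have hh := localize_or_meet cW1 nW1.1 W21 hK.
have k0 := kob_ge0 oO cO Ox Oy.
have [[_ h1]|[q [t [Kq xq kq tq tE]]]] := hh x y Ox W2x Oy.
  by apply: le_trans h1 _; rewrite -/C4; lra.
have [[_ h1]|[q' [t' [Kq' yq' kq' tq' tE']]]] := hh y x Oy W2y Ox.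
  rewrite kob_comp_sym//; apply: le_trans h1 _.
  by rewrite -/C4 (kobC oO cO Oy Ox); lra.
have qq' : connected_component D q q'.
  by apply: connected_component_trans (connected_component_trans xy yq'); exact: connected_component_sym.
have Oq := K3O _ Kq; have Oq' := K3O _ Kq'.
have h1 := kob_comp_tri oD xq (connected_component_trans qq' (connected_component_sym yq')).
have h2 := kob_comp_tri oD qq' (connected_component_sym yq').
rewrite -(kob_comp_sym oD yq') in h2.
have h3 : kob_comp D q q' <= Num.max M 0 by rewrite le_max (hM q q' Kq Kq' qq').
have h4 : k q q' <= Num.max M' 0 by rewrite le_max -(kE _ Oq) (hM' q q' Kq Kq' (OO Oq Oq')).
have h5 := kobD oO cO Oy Oq Oq'; rewrite (kobC oO cO Oy Oq) in h5.
rewrite -/C4 in kq kq'; lra.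
Qed.

End Additive.

End ExteriorEstimate.


(** * Integrals against a stepwise weight *)

Section WeightedIntegral.
Context d (T : measurableType d) {R : realType} (mu : {measure set T -> \bar R}).
(** The bound f1 <= w f2 cannot simply be integrated, as f2 need not be measurable. For a simple h
    below f1, the quotient h / w is measurable and below f2, and expanding (h / w) w leaves
    integrals of h / w over D and over each [I j]. *)
Lemma weighted_integral_le (D : set T) (f1 f2 : T -> \bar R) (N : nat) (I : nat -> set T)
    (c b : nat -> R) (B : R) (w := fun x => 1 + \sum_(j < N) c j * \1_(I j) x) :
  measurable D -> (forall j, measurable (I j)) -> (forall j, I j `<=` D) ->
  (forall j, 0 <= c j) ->
  (forall x, D x -> (0 <= f1 x)%E) -> (forall x, D x -> (0 <= f2 x)%E) ->
  (forall x, D x -> ((w x)^-1%:E * f1 x <= f2 x)%E) ->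
  (\int[mu]_(x in D) f2 x <= B%:E)%E ->
  (forall j, \int[mu]_(x in I j) f2 x <= (b j)%:E)%E ->
  (\int[mu]_(x in D) f1 x <= (B + \sum_(j < N) c j * b j)%:E)%E.
Proof.
move=> mD mI ID c0 f10 f20 hw hB hb; apply: lower_integral_sup => // h hf1.
have ind0 j x : 0 <= \1_(I j) x :> R by rewrite indicE ler0n.
have w0 x : 0 < w x.
  by rewrite /w ltr_wpDr// sumr_ge0// => j _; rewrite mulr_ge0.
pose g x := h x * (w x)^-1.
have g0 x : 0 <= g x by rewrite mulr_ge0// invr_ge0 ltW.
have mw : measurable_fun setT w.
  apply: measurable_funD => //; apply: measurable_sum => j; exact: measurable_funM.
have mg A : measurable A -> measurable_fun A g.
  move=> mA; apply: measurable_funTS; apply: measurable_funM => //.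
  have -> : (fun x => (w x)^-1) = (fun r : R => r `^ (-1)) \o w.
    by apply/funext => x /=; rewrite powR_inv1// ltW.
  exact: (measurableT_comp (measurable_powR _)).
have gf2 x : D x -> ((g x)%:E <= f2 x)%E.
  move=> Dx; apply: le_trans (hw _ Dx); rewrite /g mulrC EFinM lee_wpmul2l ?hf1//.
  by rewrite lee_fin invr_ge0 ltW.
have hE x : (h x)%:E = ((g x)%:E + \sum_(j < N) ((c j)%:E * ((g \_ (I j)) x)%:E))%E.
  have -> : h x = g x * w x by rewrite /g divfK// gt_eqF.
  rewrite /w mulrDr mulr1 EFinD mulr_sumr -sumEFin; congr (_ + _)%E; apply: eq_bigr => j _.
  rewrite -EFinM; congr EFin; rewrite patchE indicE.
  by case: (x \in I j); rewrite ?mulr1 ?mulr0// mulrC.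
have g_0 j x : 0 <= (g \_ (I j)) x by rewrite patchE; case: ifP.
have mgI j : measurable_fun D (fun x => ((g \_ (I j)) x)%:E).
  apply/measurable_EFinP; apply: measurable_funTS.
  by apply/(measurable_restrictT _ _).1 => //; exact: mg.
under eq_integral do rewrite hE.
rewrite ge0_integralD//=; last 4 first.
- by move=> x _; rewrite lee_fin.
- by apply/measurable_EFinP; exact: mg.
- by move=> x _; apply: sume_ge0 => j _; rewrite mule_ge0 ?lee_fin.
- apply: emeasurable_sum => j _; exact: measurable_funeM.
rewrite ge0_integral_sum//; last 2 first.
- by move=> j; exact: measurable_funeM.
- by move=> j x _; rewrite mule_ge0 ?lee_fin.
rewrite EFinD -sumEFin; apply: leeD.
  by apply: le_trans hB; apply: lower_integral_le => // x _; rewrite lee_fin.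
apply: lee_sum => j _; rewrite ge0_integralZl_EFin//; last by move=> x _; rewrite lee_fin.
rewrite EFinM lee_wpmul2l ?lee_fin//.
have -> : (\int[mu]_(x in D) ((g \_ (I j)) x)%:E = \int[mu]_(x in I j) (g x)%:E)%E.
  rewrite -[in RHS](setIidr (@ID j)) integral_mkcondr; apply: eq_integral => x _.
  by rewrite !patchE; case: ifP.
apply: le_trans (hb j); apply: lower_integral_le => x Ix; first by rewrite lee_fin.
by apply: gf2; exact: (@ID j).
Qed.

End WeightedIntegral.

(** * Royden length of geodesics close to p *)

Section Length.
Context {R : realType} {n : nat}.
Local Notation E := 'rV[Cx R]_n.
Implicit Types (phi : Cx R -> E) (g : R -> E) (x y z : E).

Lemma sum_expRN (N : nat) : \sum_(j < N) (j%:R + 1) * expR (- (2 * j%:R)) <= 2 :> R.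
Proof.
have e2 : expR (-1) <= 1 / 2 :> R.
  have : (expR 1)^-1 <= 2^-1 :> R.
    by rewrite lef_pV2 ?posrE ?expR_gt0//; have := expR_ge1Dx (1 : R); lra.
  by rewrite expRN; lra.
(* Induction on this sharper bound: N + 1 <= exp N makes the new term at most exp (- N), which the
   increment covers since exp (-1) <= 1/2. *)
apply: (@le_trans _ _ (2 - 2 * expR (- N%:R))); last first.
  by have := expR_gt0 (- N%:R : R); lra.
elim: N => [|N IH]; first by rewrite big_ord0 oppr0 expR0 mulr1 subrr.
rewrite big_ord_recr /=; apply: le_trans (lerD IH (lexx _)) _.
have -> : - N.+1%:R = - N%:R + (-1) :> R by rewrite -natr1 opprD.
rewrite expRD; have E0 := expR_gt0 (- N%:R : R).
have -> : - (2 * N%:R) = - N%:R + - N%:R :> R by ring.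
rewrite expRD; have := expR_ge1Dx (N%:R : R).
have NE : expR N%:R * expR (- N%:R) = 1 :> R by rewrite -expRD subrr expR0.
set X := expR (- N%:R) in E0 NE *; set Y := expR N%:R in NE *; set Z := expR (-1) in e2 *.
move=> hY; have h1 : (N%:R + 1) * X <= 1.
  by rewrite -[leRHS]NE ler_wpM2r ?(ltW E0)//; lra.
have h2 : (N%:R + 1) * (X * X) <= X by rewrite mulrA ler_piMl// ltW.
have h3 : X * Z <= X * (1 / 2) by rewrite ler_wpM2l// ltW.
lra.
Qed.

Lemma cont_compact g (a b : R) : cont_curve a b g -> compact (g @` `[a, b]).
Proof.
move=> cg; apply: continuous_compact; last exact: segment_compact.
apply/subspace_continuousP => u; rewrite /= in_itv /= => uab.
apply/cvgrPdist_lt => e /gt0_rc[-> e0]; have [d d0 hd] := cg u uab _ e0.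
apply/nbhs_ballP; exists d => // v; rewrite /ball /= in_itv /= => uv vab.
by rewrite distrC rnormE ltr_rc; apply: hd => //; rewrite distrC.
Qed.

Variables (Omega U : set E) (o : E).
Hypotheses (oO : open Omega) (cO : connected Omega) (oU : open U) (Oo : Omega o).
Let D := Omega `&` U.
Local Notation k := (kobayashi Omega).
Variables (V : set E) (C : R).
Hypotheses (C0 : 0 <= C).
Hypothesis hV : forall z, Omega z -> V z -> safe Omega U z (1 + C * expR (- (2 * k z o)))^-1.

Lemma kob_cont g (a b : R) : cont_curve a b g -> (forall t, a <= t <= b -> Omega (g t)) ->
  forall t, a <= t <= b -> forall e, 0 < e ->
  exists2 d, 0 < d & forall s, a <= s <= b -> `|s - t| < d -> `|k (g s) o - k (g t) o| < e.
Proof.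
move=> cg gO t tab e e0; have Ot := gO _ tab.
have [r r0 rO] := open_rballP oO Ot.
have e' : 0 < Num.min (r / 2) (e * r / 2) by rewrite lt_min !divr_gt0//= mulr_gt0.
have [d d0 hd] := cg t tab _ e'; exists d => // s sab st.
have := hd s sab st; rewrite lt_min => /andP[h1 h2]; have Os := gO _ sab.
have h3 := kob_local oO cO r0 rO (ltW h1).
have h4 : 2 / r * rnorm (g s - g t) < e by rewrite mulrAC ltr_pdivrMr//; lra.
have h5 := kobD oO cO Os Ot Oo; have h6 := kobD oO cO Ot Os Oo.
rewrite (kobC oO cO Os Ot) in h5.
by rewrite ltr_norml; apply/andP; split; lra.
Qed.

Let kroy G g (t : R) := kobayashi_royden (connected_component G (g t)) (g t) (curve_derivative g t).

(* The times at which [k (g u) o <= M] lie in a time interval whose length is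
   controlled by the geodesic inequality between its end points. *)
Let sublevel g (lam eps a b s t M : R) : 0 <= lam -> 0 <= eps -> 0 <= M ->
  geodesic lam eps Omega a b g -> a <= s -> s <= t -> t <= b ->
  exists I : set R, [/\ measurable I, I `<=` `[s, t]%classic,
    (forall u, s <= u <= t -> k (g u) o <= M -> I u) &
    (\int[lebesgue_measure]_(u in I) kroy Omega g u <= (lam * (2 * M) + eps)%:E)%E].
Proof.
move=> l0 e0 M0 [ab gO acg hg] as_ st tb.
have B0 : 0 <= lam * (2 * M) + eps by rewrite addr_ge0// !mulr_ge0.
pose F := [set u | s <= u <= t /\ k (g u) o <= M].
have [[u0 Fu0]|F0] := pselect (F !=set0); last first.
  exists set0; split => //; last by rewrite integral_set0 lee_fin.
  by move=> u ust kM; apply: F0; exists u.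
have iab u : s <= u <= t -> a <= u <= b by move=> /andP[su ut]; apply/andP; split; lra.
have kc := kob_cont (acc_cont acg) gO.
have iF : has_inf F by split; [exists u0 | exists s => u [/andP[]]].
have sF : has_sup F by split; [exists u0 | exists t => u [/andP[]]].
have infs : s <= inf F by apply: lb_le_inf; [exists u0 | move=> u [/andP[]]].
have supt : sup F <= t by apply: ge_sup; [exists u0 | move=> u [/andP[]]].
have lo u : F u -> inf F <= u by apply: ge_inf; case: iF.
have hi u : F u -> u <= sup F by apply: ub_le_sup; case: sF.
have is_ : inf F <= sup F by exact: le_trans (lo _ Fu0) (hi _ Fu0).
have iI : s <= inf F <= t by apply/andP; split; lra.
have sI : s <= sup F <= t by apply/andP; split; lra.
have close v : s <= v <= t -> (forall d, 0 < d -> exists2 u, F u & `|u - v| < d) -> k (g v) o <= M.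
  move=> vst hv; rewrite leNgt; apply/negP => kM.
  have p0 : 0 < k (g v) o - M by rewrite subr_gt0.
  have [d d0 hd] := kc v (iab _ vst) _ p0; have [u [ust uM] uv] := hv d d0.
  by have := hd u (iab _ ust) uv; rewrite ltr_norml => /andP[]; lra.
have kinf : k (g (inf F)) o <= M.
  apply: close => // d d0; have [u Fu ud] := inf_adherent d0 iF; exists u => //.
  by rewrite ger0_norm ?subr_ge0 ?lo//; lra.
have ksup : k (g (sup F)) o <= M.
  apply: close => // d d0; have [u Fu ud] := sup_adherent d0 sF; exists u => //.
  by rewrite ler0_norm ?subr_le0 ?hi//; lra.
(* By continuity k <= M persists at both end points, so their distance is at most 2 M. *)
exists `[inf F, sup F]%classic; split => //.
- by move=> u; rewrite /= !in_itv /= => /andP[u1 u2]; apply/andP; split; lra.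
- by move=> u ust kM; rewrite /= in_itv /= lo ?hi.
apply: le_trans (hg _ _ (le_trans as_ infs) is_ (le_trans supt tb)) _.
have Oi := gO _ (iab _ iI); have Os := gO _ (iab _ sI).
rewrite lee_fin lerD2r ler_wpM2l// connected_component_id//.
by have := kobD oO cO Oi Oo Os; rewrite (kobC oO cO Oo Os); lra.
Qed.

(** The weight is summed by levels: where k(g u, o) is between j and j + 1 it is at most 1 + C exp
    (- 2 j), and such times lie in a set of Omega-length at most 2 lam (j + 1) + eps. *)
Lemma royden_length_localize g (lam eps a b : R) : 0 <= lam -> 0 <= eps ->
  geodesic lam eps Omega a b g -> (forall t, a <= t <= b -> V (g t)) ->
  forall s t, a <= s -> s <= t -> t <= b ->
  (royden_length D g s t <=
   (lam * k (g s) (g t) + eps + 2 * (C * (2 * lam + eps)))%:E)%E.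
Proof.
move=> l0 e0 gg gV s t as_ st tb; have [ab gO acg hg] := gg.
have iab u : s <= u <= t -> a <= u <= b by move=> /andP[su ut]; apply/andP; split; lra.
have [M hM] : exists M, forall u, s <= u <= t -> k (g u) o <= M.
  have cK := cont_compact (acc_cont acg).
  have cK' : compact ((g @` `[a, b]) `|` [set o]) by apply: compactU => //; exact: compact_set1.
  have KO : (g @` `[a, b]) `|` [set o] `<=` Omega.
    by move=> _ [[u + <-]|->//]; rewrite /= in_itv /=; exact: gO.
  have [M hM] := kob_comp_bounded oO cK' KO; exists M => u ust.
  have Ou := gO _ (iab _ ust).
  have := hM (g u) o (or_introl _) (or_intror erefl); rewrite kob_compE//; apply.
    by exists u => //; rewrite /= in_itv /=; exact: iab.
  by rewrite connected_component_id.
(* As k(., o) is bounded along the compact curve, finitely many levels suffice. *)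
pose N := (Num.truncn M).+1.
have [I hI] := choice (fun j : nat => sublevel l0 e0 (ltac:(by rewrite addr_ge0) : 0 <= j%:R + 1) gg as_ st tb).
pose c (j : nat) := C * expR (- (2 * j%:R)).
have c0 j : 0 <= c j by rewrite mulr_ge0// expR_ge0.
have := @weighted_integral_le _ _ R lebesgue_measure `[s, t]%classic (kroy D g) (kroy Omega g) N I c
  (fun j => lam * (2 * (j%:R + 1)) + eps) (lam * k (g s) (g t) + eps).
move=> /(_ _ _ _ c0 _ _ _ _ _)/le_trans; apply.
- by [].
- by move=> j; case: (hI j).
- by move=> j; case: (hI j).
- by move=> u _; exact: kobayashi_royden_ge0.
- by move=> u _; exact: kobayashi_royden_ge0.
- move=> u; rewrite /= in_itv /= => ust; have uab := iab _ ust; have Ou := gO _ uab.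
  set w := 1 + _.
  have sw : safe Omega U (g u) w^-1.
    apply: safe_le (hV Ou (gV _ uab)).
    have kp : 0 <= C * expR (- (2 * k (g u) o)) by rewrite mulr_ge0// expR_ge0.
    have w0 : 0 < w.
      by rewrite /w ltr_wpDr// sumr_ge0// => j _; rewrite mulr_ge0// indicE ler0n.
    rewrite lef_pV2 ?posrE//; last by rewrite ltr_wpDr.
    rewrite lerD2l; have ku0 := kob_ge0 oO cO Ou Oo.
    have /andP[j1 j2] := truncn_itv ku0; set j := Num.truncn _ in j1 j2.
    have jN : (j < N)%N.
      rewrite /N ltnS; apply: le_truncn; exact: hM.
    rewrite (bigD1 (Ordinal jN)) //= ler_wpDr//.
      by apply: sumr_ge0 => i _; rewrite mulr_ge0// indicE ler0n.
    have -> : \1_(I j) u = 1 :> R.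
      rewrite indicE mem_set//; have [_ _ + _] := hI j; apply => //.
      by rewrite natr1 ltW.
    rewrite mulr1 /c ler_wpM2l// ler_expR lerN2; lra.
  have w1 : 1 <= w.
    by rewrite /w lerDl sumr_ge0// => j _; rewrite mulr_ge0// indicE ler0n.
  rewrite /kroy [connected_component Omega (g u)]connected_component_id//.
  apply: royden_localize => //.
  by rewrite invr_gt0 (lt_le_trans ltr01 w1)//= invf_le1// (lt_le_trans ltr01 w1).
- by have := hg s t as_ st tb; rewrite connected_component_id//; apply: gO; apply: iab; rewrite lexx.
- by move=> j; case: (hI j).
rewrite lee_fin lerD2l.
have c1 : 0 <= C * (2 * lam + eps) by rewrite !mulr_ge0// addr_ge0// mulr_ge0.
rewrite mulrC; apply: le_trans (ler_wpM2l c1 (sum_expRN N)).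
rewrite mulr_sumr; apply: ler_sum => j _; rewrite /c.
(* This is what is lost in replacing eps by eps (j + 1), so that the whole term is a multiple of (j
   + 1) exp (- 2 j). *)
have ej : 0 <= C * (eps * (j%:R * expR (- (2 * j%:R)))).
  by rewrite !mulr_ge0// expR_ge0.
rewrite -subr_ge0; apply: le_trans ej _; rewrite le_eqVlt; apply/orP; left; apply/eqP; ring.
Qed.

End Length.


(** * The two implications *)

Section Equivalence.
Context {R : realType} {n : nat}.
Local Notation E := 'rV[Cx R]_n.

Lemma kobayashi_royden_mono (G G' : set E) x v : G `<=` G' ->
  (kobayashi_royden G' x v <= kobayashi_royden G x v)%E.
Proof.
move=> GG; apply: ereal_inf_le_tmp => _ [a [phi [h p0 av]] <-].
by exists a => //; exists phi; split => //; exact: holo_mono h.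
Qed.

Variables (A lam : R) (Omega U : set E) (p o : E).
Hypotheses (hA : schwarz_bound (R := R) (n := n) A) (oO : open Omega) (cO : connected Omega).
Hypotheses (hp : hyperbolic_at Omega p) (nU : neighbourhood p U) (bU : bounded_set U) (Oo : Omega o).
Hypothesis lam1 : 1 <= lam.
Let D := Omega `&` U.
Let oU : open U. Proof. by case: nU. Qed.
Let oD : open D. Proof. exact: openI. Qed.
Let l0 : 0 <= lam. Proof. exact: le_trans lam1. Qed.

(** A geodesic of D that stays in W is one of Omega: its length does not grow, and replacing k_D by
    k_Omega + M turns eps into lam M + eps. *)
Lemma visible_local_of_global : visible_point lam Omega p -> visible_point lam D p.
Proof.
move=> vis.
have vis1 : visible_point_eps 1 1 Omega p.
  by apply: visible_weaken (vis 1 ler01).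
have [V [C [nV VU C0 hV]]] :=
  safe_of_exterior_estimate hA oO cO hp nU (exterior_estimate_global hA oO cO nU bU Oo vis1).
have [W [M [nW WV M0 hM]]] := kob_additive hA oO cO nU Oo nV VU C0 hV vis1.
move=> eps e0 U1 nU1 bU1.
have [W3 [nW3 bW3 cW3 _]] := neighbourhood_ball (neighbourhoodI nW nU1).
have e'0 : 0 <= lam * M + eps by rewrite addr_ge0// mulr_ge0.
have [V3 [K [nV3 [cV3 V3W3] cK KO hK]]] := vis _ e'0 W3 nW3 bW3.
(* K is known to lie in Omega only. The curve meets it no later than its exit from W3, so the
   meeting point can be kept in the closure of W3, inside U. *)
exists V3, (K `&` closure W3); split => //.
- split => // y /V3W3/subset_closure/cW3[]//.
- apply: compact_closedI => //; exact: closed_closure.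
- by move=> y [/KO Oy /cW3[/WV/VU Uy _]].
move=> a b g gg [[Oa Ua] V3a] [_ U1b].
have [ab gD acg hg] := gg.
have cg := acc_cont acg.
have W3a : W3 (g a) by apply/V3W3/subset_closure.
have W3b : ~ W3 (g b) by move=> /subset_closure/cW3[].
have [t [tab Wt gW]] := first_exit cg ab nW3.1 W3a W3b.
have /andP[at_ tb] := tab.
have gO s : a <= s <= b -> Omega (g s) by move=> /gD[].
have gW' s : a <= s <= t -> W (g s) by move=> /gW/cW3[].
have gsub := geodesic_sub gg at_ tb.
have gOm : geodesic lam (lam * M + eps) Omega a t g.
  have [_ _ acgt _] := gsub; split => //.
    by move=> s /andP[as_ st]; apply: gO; rewrite as_ (le_trans st).
  move=> s u as_ su ut.
  have ub := le_trans ut tb.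
  have sab : a <= s <= b by rewrite as_ (le_trans su).
  have uab : a <= u <= b by rewrite ub (le_trans as_).
  apply: (@le_trans _ _ (royden_length D g s u)).
    apply: lower_integral_le => v _; first exact: kobayashi_royden_ge0.
    apply: kobayashi_royden_mono => y [B [Bx BD cB By]].
    by exists B => //; split => //; move=> z /BD[].
  apply: le_trans (hg _ _ as_ su ub) _; rewrite lee_fin.
  rewrite (connected_component_id (gO _ sab) cO) addrA lerD2r -mulrDr ler_wpM2l//.
  apply: hM.
  - by apply: gW'; rewrite as_ (le_trans su).
  - by apply: gW'; rewrite ut (le_trans as_).
  - exact: (cont_connected cg gD).
have [||q qt Kq] := hK a t g gOm.
- by split.
- by split => //; exact: gO.
exists q; first by have /andP[-> qt'] := qt; exact: le_trans tb.
by split => //; exact: gW.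
Qed.

(** A geodesic of Omega that stays in V is one of D: k_Omega <= k_D on a component, and localizing
    the length adds 2 C (2 lam + eps) to eps. *)
Lemma visible_global_of_local : visible_point lam D p -> visible_point lam Omega p.
Proof.
move=> vis.
have vis1 : visible_point_eps 1 1 D p.
  by apply: visible_weaken (vis 1 ler01).
have [V [C [nV VU C0 hV]]] :=
  safe_of_exterior_estimate hA oO cO hp nU (exterior_estimate_local hA oO cO hp nU Oo vis1).
move=> eps e0 U1 nU1 bU1.
have [W3 [nW3 bW3 cW3 _]] := neighbourhood_ball (neighbourhoodI nV nU1).
have e'0 : 0 <= eps + 2 * (C * (2 * lam + eps)).
  by rewrite addr_ge0// mulr_ge0// mulr_ge0// addr_ge0// mulr_ge0.
have [V3 [K [nV3 [cV3 V3W3] cK KD hK]]] := vis _ e'0 W3 nW3 bW3.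
exists V3, K; split => //.
- split => // y /V3W3/subset_closure/cW3[]//.
- by move=> y /KD[].
move=> a b g gg [Oa V3a] [_ U1b].
have [ab gO acg hg] := gg.
have cg := acc_cont acg.
have W3a : W3 (g a) by apply/V3W3/subset_closure.
have W3b : ~ W3 (g b) by move=> /subset_closure/cW3[].
have [t [tab Wt gW]] := first_exit cg ab nW3.1 W3a W3b.
have /andP[at_ tb] := tab.
have gV s : a <= s <= t -> V (g s) by move=> /gW/cW3[].
have gsub := geodesic_sub gg at_ tb.
have gD s : a <= s <= t -> D (g s).
  by move=> st; split; [case: gsub => _ + _ _; exact | apply/VU/gV].
have gDm : geodesic lam (eps + 2 * (C * (2 * lam + eps))) D a t g.
  have [_ _ acgt _] := gsub; split => // s u as_ su ut.
  have hl := royden_length_localize oO cO Oo C0 hV l0 e0 gsub gV as_ su ut.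
  apply: le_trans hl _.
  have sat : a <= s <= t by rewrite as_ (le_trans su).
  have uat : a <= u <= t by rewrite ut (le_trans as_).
  rewrite lee_fin -addrA lerD2r ler_wpM2l//.
  have Os : Omega (g s) by have [] := gD _ sat.
  rewrite -(kob_compE _ cO Os); apply: kob_comp_mono => //; first by move=> ? [].
  exact: (cont_connected (acc_cont acgt) gD).
have aat : a <= a <= t by rewrite lexx.
have tat : a <= t <= t by rewrite at_ lexx.
have [||q /andP[aq qt] Kq] := hK a t g gDm.
- by split => //; exact: gD.
- by split => //; exact: gD.
by exists q => //; rewrite aq (le_trans qt).
Qed.

End Equivalence.

Theorem theorem15 (R : realType) (n : nat) (Omega : set 'rV[Cx R]_n)
    (lambda : R) (p : 'rV[Cx R]_n) :
  domain Omega -> hyperbolic Omega -> 1 <= lambda ->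
  boundary Omega p -> hyperbolic_at Omega p ->
  [<-> visible_point lambda Omega p;
       exists U : set 'rV[Cx R]_n,
         [/\ neighbourhood p U, bounded_set U &
             visible_point lambda (Omega `&` U) p];
       forall U : set 'rV[Cx R]_n, neighbourhood p U -> bounded_set U ->
         visible_point lambda (Omega `&` U) p].
Proof.
move=> dO hO lam1 _ hp; have [oO cO [z0 Oo]] := dO.
have [A hA] := schwarz_exists dO hO.
have gl U : neighbourhood p U -> bounded_set U ->
    visible_point lambda Omega p -> visible_point lambda (Omega `&` U) p.
  move=> nU bU; exact: (visible_local_of_global hA oO cO hp nU bU Oo lam1).
have [U0 [nU0 bU0 _ _]] : exists W', [/\ neighbourhood p W', bounded_set W',
    closure W' `<=` setT & W' `<=` setT].
  by apply: neighbourhood_ball; split => //; exact: openT.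
tfae.
- by move=> vis; exists U0; split => //; exact: gl.
(* The change of neighbourhood passes through Omega. *)
- move=> [U [nU bU vis]] U' nU' bU'; apply: gl => //.
  exact: (visible_global_of_local hA oO cO hp nU Oo lam1 vis).
- move=> vis; apply: (visible_global_of_local hA oO cO hp nU0 Oo lam1).
  exact: vis.
Qed.
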